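(* Let $E\in\mathcal M(J,\{n_k\},\{r_k\})$ be a Moran set with $r=\inf_k r_k>0$, with Moran structure $\{J_{\mathbf i}:\mathbf i\in D\}$, and let $(X,\mathcal E)$ be the augmented tree induced by it. Then: (i) $(X,\mathcal E)$ is a hyperbolic graph in the sense of Gromov. (ii) $E$ is homeomorphic to the hyperbolic boundary $\partial(X,\mathcal E)$. Furthermore, suppose in addition that there is a constant $C'>0$ such that for any $n\ge 1$ and any $\mathbf u,\mathbf v\in X_n$, either $J_{\mathbf u}\cap J_{\mathbf v}\neq\emptyset$ or $\operatorname{dist}(J_{\mathbf u},J_{\mathbf v})\ge C' r^n$. Then $\partial(X,\mathcal E)$ and $E$ are Hölder equivalent: there exist a bijection $\Phi:\partial(X,\mathcal E)\to E$ and constants $C,\alpha>0$ such that $$C^{-1}|\Phi(\xi)-\Phi(\eta)|\le \rho_a(\xi,\eta)^{\alpha}\le C|\Phi(\xi)-\Phi(\eta)|\qquad\text{for all }\xi,\eta\in\partial(X,\mathcal E).$$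
   Context: **Moran sets.** Let $\{n_k\}_{k\ge1}$ be positive integers and $\{r_k\}_{k\ge1}$ positive numbers with $n_k\ge2$, $0<r_k<1$, $n_kr_k\le1$. Let $D_0=\{\emptyset\}$ (the empty word), $D_k=\prod_{j=1}^k\{1,\dots,n_j\}$, $D=\bigcup_{k\ge0}D_k$; concatenation of words is denoted by juxtaposition. $|A|$ denotes the diameter of a set $A$, and $\operatorname{dist}(A,B)$ the Euclidean distance (infimum) between sets. Let $J\subset\mathbb R^d$ be compact with nonempty interior. A collection $\{J_{\mathbf i}:\mathbf i\in D\}$ of subsets of $J$ has the Moran structure if: (1) $J_\emptyset=J$; (2) for each $\mathbf i\in D$ there is a similarity $S_{\mathbf i}:\mathbb R^d\to\mathbb R^d$ with $J_{\mathbf i}=S_{\mathbf i}(J)$; (3) for every $k\ge1$ and $\mathbf i\in D_{k-1}$, the sets $J_{\mathbf i1},\dots,J_{\mathbf in_k}$ are subsets of $J_{\mathbf i}$ with pairwise disjoint interiors; (4) for every $k\ge1$, $\mathbf i\in D_{k-1}$, $1\le j\le n_k$, $|J_{\mathbf ij}|/|J_{\mathbf i}|=r_k$. The set $E=\bigcap_{k\ge0}\bigcup_{\mathbf i\in D_k}J_{\mathbf i}$ is the (homogeneous) Moran set, and $\mathcal M(J,\{n_k\},\{r_k\})$ is the class of all such sets. **Induced augmented tree.** Let $r=\inf_kr_k>0$. Put $X_0=\{\emptyset\}$ and, for $n\ge1$, $X_n=\{i_1\cdots i_k\in D: r_1\cdots r_k\le r^n<r_1\cdots r_{k-1}\}$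 (for $k=1$ the empty product is $1$). Let $X=\bigcup_{n\ge0}X_n$. For $n\ge1$ each $\mathbf u\in X_n$ has a unique prefix $\mathbf u^{-1}\in X_{n-1}$ (its parent). The vertical edges $\mathcal E_v$ join $\mathbf u^{-1}$ and $\mathbf u$ for $\mathbf u\in X\setminus\{\emptyset\}$. The horizontal edges $\mathcal E_h$ join $\mathbf u\ne\mathbf v$ in the same $X_n$, $n\ge1$, with $J_{\mathbf u}\cap J_{\mathbf v}\neq\emptyset$. Let $\mathcal E=\mathcal E_v\cup\mathcal E_h$; $(X,\mathcal E)$ is the augmented tree induced by $E$, with root $o=\emptyset$. **Hyperbolicity and boundary.** Let $d$ be the graph distance, $|x|=d(o,x)$, and $|x\wedge y|=\frac12(|x|+|y|-d(x,y))$ the Gromov product. The graph is hyperbolic if there is $\delta>0$ with $|x\wedge y|\ge\min\{|x\wedge z|,|z\wedge y|\}-\delta$ for all vertices $x,y,z$. Fix $a>0$ with $\exp(\delta a)-1<\sqrt2-1$ and set $\rho_a(x,y)=\exp(-a|x\wedge y|)$ for $x\ne y$, $\rho_a(x,x)=0$. Then $\rho_a$ is equivalent to a genuine metric and is treated as a metric. $\hat X$ is the completion of $X$ under $\rho_a$, and $\partial X=\hat X\setminus X$ is the hyperbolic boundary, with the extended metric $\rho_a(\xi,\eta)=\exp(-a|\xi\wedge\eta|)$ for $\xi\neq\eta$, where $|\xi\wedge\eta|$ is the standard extension of the Gromov product to the boundary, e.g. $\sup\liminf_{n}|x_n\wedge y_n|$ over sequences $x_n\to\xi$, $y_n\to\eta$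 (other standard choices change $\rho_a$ only by bounded factors). *)

(* Defs.v *)
From HB Require Import structures.
From mathcomp Require Import all_boot all_order all_algebra.
From mathcomp Require Import all_classical all_reals all_analysis.

Set Implicit Arguments.
Unset Strict Implicit.
Unset Printing Implicit Defensive.

Import Order.TTheory GRing.Theory Num.Theory.
Import numFieldNormedType.Exports.

Local Open Scope classical_set_scope.
Local Open Scope ring_scope.

(* The library's norm on ['rV_d] is the sup norm; it induces the same topology
   as the Euclidean norm, so [compact] and [interior] are the usual ones. *)
Section Euclidean.
Variables (R : realType) (d : nat).
Implicit Types A B : set 'rV[R]_d.

Definition eucl_norm (x : 'rV[R]_d) : R := Num.sqrt (\sum_i x ord0 i ^+ 2).

Definition eucl_diam A : R := sup [set eucl_norm (x - y) | x in A & y in A].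

Definition eucl_dist A B : R := inf [set eucl_norm (x - y) | x in A & y in B].

Definition similarity (S : 'rV[R]_d -> 'rV[R]_d) : Prop :=
  exists2 c : R, 0 < c &
    forall x y, eucl_norm (S x - S y) = c * eucl_norm (x - y).

End Euclidean.

(* The sequences n and r are indexed from 1: their values at 0 are never used. *)
Section Moran.
Variables (R : realType) (d : nat) (n : nat -> nat) (r : nat -> R).

Definition words (k : nat) : set (seq nat) :=
  [set w | size w = k /\
           forall j, (j < k)%N -> (1 <= nth 0%N w j <= n j.+1)%N].

Definition all_words : set (seq nat) := \bigcup_k words k.

Definition moran_structure (J : set 'rV[R]_d) (Jf : seq nat -> set 'rV[R]_d) :
    Prop :=
  [/\ Jf [::] = J,
      forall w, all_words w -> Jf w `<=` J /\
        exists2 S, similarity S & Jf w = S @` J,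
      forall k w, words k w ->
        (forall j, (1 <= j <= n k.+1)%N -> Jf (rcons w j) `<=` Jf w) /\
        (forall i j, (1 <= i <= n k.+1)%N -> (1 <= j <= n k.+1)%N -> i <> j ->
           interior (Jf (rcons w i)) `&` interior (Jf (rcons w j)) = set0) &
      forall k w j, words k w -> (1 <= j <= n k.+1)%N ->
        eucl_diam (Jf (rcons w j)) / eucl_diam (Jf w) = r k.+1].

Definition moran_set (Jf : seq nat -> set 'rV[R]_d) : set 'rV[R]_d :=
  \bigcap_k \bigcup_(w in words k) Jf w.

Definition inf_ratio : R := inf [set r k | k in [set k | (1 <= k)%N]].

Definition ratio_prod (k : nat) : R := \prod_(1 <= j < k.+1) r j.

Definition level (m : nat) : set (seq nat) :=
  if m is 0%N then [set [::]] else
  [set w | exists2 k, words k.+1 w &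
             ratio_prod k.+1 <= inf_ratio ^+ m < ratio_prod k].

Definition vertices : set (seq nat) := \bigcup_m level m.

Lemma root_subproof : [::] \in vertices.
Proof. by apply/mem_set; exists 0%N. Qed.

Definition aug_root : vertices := exist _ [::] root_subproof.

Definition parent (u v : seq nat) : Prop :=
  exists m, [/\ level m.+1 u, level m v & prefix v u].

Definition horizontal (Jf : seq nat -> set 'rV[R]_d) (u v : seq nat) : Prop :=
  u <> v /\
  exists m, [/\ level m.+1 u, level m.+1 v & Jf u `&` Jf v !=set0].

Definition aug_edge (Jf : seq nat -> set 'rV[R]_d) : rel vertices :=
  fun u v => `[< [\/ parent (val u) (val v), parent (val v) (val u) |
                     horizontal Jf (val u) (val v)] >].

End Moran.

Arguments level {R} n r m.
Arguments vertices {R} n r.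
Arguments aug_edge {R d} n r Jf.

(* A graph is a vertex type V with an adjacency relation e and a root o.  It is
   meant to be connected: between two vertices joined by no path, [gdist] has
   the junk value 0. *)
Section Hyperbolic.
Variables (R : realType) (V : choiceType) (e : rel V) (o : V).

Definition gdist (x y : V) : R :=
  inf [set (size p)%:R | p in [set p | path e x p /\ last x p = y]].

Definition gromov_prod (x y : V) : R :=
  (gdist o x + gdist o y - gdist x y) / 2.

Definition hyperbolic_with (delta : R) : Prop := forall x y z,
  Num.min (gromov_prod x z) (gromov_prod z y) - delta <= gromov_prod x y.

Definition hyperbolic : Prop := exists2 delta, 0 < delta & hyperbolic_with delta.

Definition rho (a : R) (x y : V) : R :=
  if x == y then 0 else expR (- a * gromov_prod x y).

Definition rho_cauchy (a : R) (u : nat -> V) : Prop :=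
  forall eps : R, 0 < eps ->
    exists N, forall i j, (N <= i)%N -> (N <= j)%N -> rho a (u i) (u j) < eps.

Definition cauchy_class (a : R) (u : nat -> V) : set (nat -> V) :=
  [set v | rho_cauchy a v /\ rho a (u i) (v i) @[i --> \oo] --> (0 : R)].

(* The completion of V is the set of classes of rho-Cauchy sequences modulo
   rho (u i) (v i) --> 0, which is an equivalence relation as soon as rho is
   equivalent to a metric. *)
Definition completion (a : R) : Type :=
  {C : set (nat -> V) | exists2 u, rho_cauchy a u & C = cauchy_class a u}.

HB.instance Definition _ (a : R) := gen_eqMixin (completion a).
HB.instance Definition _ (a : R) := gen_choiceMixin (completion a).

Lemma embed_subproof (a : R) (x : V) :
  exists2 u, rho_cauchy a u & cauchy_class a (fun=> x) = cauchy_class a u.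
Proof.
exists (fun=> x) => // eps eps0.
by exists 0%N => i j _ _; rewrite /rho eqxx.
Qed.

Definition embed (a : R) (x : V) : completion a :=
  exist _ (cauchy_class a (fun=> x)) (embed_subproof a x).

Definition hyp_boundary (a : R) : set (completion a) := ~` range (@embed a).

(* sup liminf |x_i /\ y_i| over sequences of vertices x_i --> xi, y_i --> eta:
   the sequences of vertices converging to xi in the completion are exactly the
   members of the class xi. *)
Definition gromov_prod_ext (a : R) (xi eta : completion a) : \bar R :=
  ereal_sup [set limn_einf (fun i => (gromov_prod (x i) (y i))%:E)
            | x in sval xi & y in sval eta].

(* In a hyperbolic graph [gromov_prod_ext xi eta] is finite when xi <> eta. *)
Definition rho_ext (a : R) (xi eta : completion a) : R :=
  if xi == eta then 0 else expR (- a * fine (gromov_prod_ext xi eta)).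

(* The topology of rho_ext: a set is open when it contains a rho_ext-ball
   around each of its points. *)
Definition rho_open (a : R) : set_system (completion a) :=
  [set U | forall xi, U xi ->
     exists2 eps : R, 0 < eps & forall eta, rho_ext xi eta < eps -> U eta].

Lemma rho_openT (a : R) : rho_open (@setT (completion a)).
Proof. by move=> xi _; exists 1. Qed.

Lemma rho_openI (a : R) : setI_closed (@rho_open a).
Proof.
move=> A B oA oB xi [/oA[eA eA0 hA] /oB[eB eB0 hB]].
exists (Num.min eA eB); first by rewrite lt_min eA0 eB0.
by move=> eta; rewrite lt_min => /andP[/hA ? /hB ?].
Qed.

Lemma rho_open_bigU (a : R) (I : Type) (f : I -> set (completion a)) :
  (forall i, rho_open (f i)) -> rho_open (\bigcup_i f i).
Proof.
move=> of_ xi [i _ /of_[eps eps0 h]]; exists eps => // eta /h ?.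
by exists i.
Qed.

HB.instance Definition _ (a : R) :=
  @isOpenTopological.Build (completion a) (@rho_open a)
    (@rho_openT a) (@rho_openI a) (@rho_open_bigU a).

End Hyperbolic.

Arguments hyp_boundary {R V} e o a.
Arguments hyperbolic R {V} e o.

Definition homeomorphic (T U : topologicalType) : Prop :=
  exists (f : T -> U) (g : U -> T),
    [/\ cancel f g, cancel g f, continuous f & continuous g].

(* xi, eta range over the boundary; E carries the Euclidean metric. *)
Definition hoelder_equivalent (R : realType) (d : nat) (V : choiceType)
    (e : rel V) (o : V) (a : R) (E : set 'rV[R]_d) : Prop :=
  exists (Phi : completion e o a -> 'rV[R]_d) (C alpha : R),
    [/\ set_bij (hyp_boundary e o a) E Phi, 0 < C, 0 < alpha &
        forall xi eta, hyp_boundary e o a xi -> hyp_boundary e o a eta ->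
          C^-1 * eucl_norm (Phi xi - Phi eta) <= rho_ext xi eta `^ alpha
            <= C * eucl_norm (Phi xi - Phi eta)].

(* Main.v *)
Require Import Defs.
From HB Require Import structures.
From mathcomp Require Import all_boot all_order all_algebra.
From mathcomp Require Import all_classical all_reals all_analysis.
From mathcomp Require Import ring lra zify.

Set Implicit Arguments.
Unset Strict Implicit.
Unset Printing Implicit Defensive.

Import Order.TTheory GRing.Theory Num.Theory.
Import numFieldNormedType.Exports.

Local Open Scope classical_set_scope.
Local Open Scope ring_scope.

(** The idea is to read everything off the levels of the vertices.  Since the
contraction ratio depends on the position in a word only, the words of level
[m] are all the words of one length [level_length m], and their pieces have
diameter between [rr ^+ m.+1] and [rr ^+ m] times the diameter of [J], where
[rr] is the infimum of the ratios and [rr <= 1/2].  Moreover each piece of level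
[m] contains a ball of radius comparable to [rr ^+ m] (similarities are onto,
[similarity_surjective]); these balls are disjoint, so a set of diameter
comparable to [rr ^+ m] meets boundedly many of the pieces ([packing]).  The
record [cell_tree] collects these facts, and [moran_cell_tree] establishes
them.

Hyperbolicity.  Consider a path from [x] to [y] of length [N] and put
[h = (lev x + lev y - N) / 2].  One edge changes the level by at most one, so
the vertex of the path that is [k] steps from the middle one has level at least
[h + k].  Hence the diameters of the cells along the path are dominated by a
geometric series, and the whole path stays within a multiple of [rr ^+ h] of
its origin ([short_path_spread]).  Projecting the path to level [l <= h] gives a
chain of vertices of that level, of which boundedly many are distinct by
packing; so the ancestors of [x] and [y] at level [l] are within a constant
[K] of each other ([walk_anc_of_short_walk]).  Conversely such a bound for the
ancestors gives [l - K <= gromov_prod x y] ([gromov_prod_ge]).  Thus up to a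
constant the Gromov product is the deepest level at which the ancestors are
close, and the triangle inequality for these ancestors is the hyperbolicity
([cell_tree_hyperbolic]).

The boundary.  A sequence of vertices is said to tend to [z] when for each [l]
the ancestors of level [l] of its terms eventually have [z] in their cells.
By the estimates above, the Cauchy class of a sequence that tends to [z]
consists of all the sequences that tend to [z] ([cauchy_class_tends_to]), and
a Cauchy sequence either is eventually constant or tends to a point, which
identifies the boundary with the limit set.  Cells of one level being finitely
many and closed, two points of the limit set that are close lie in cells
of level [l] that meet, so their Gromov product is large; in the other
direction a Gromov product at least [l] bounds the distance by a multiple of
[rr ^+ l].  This gives the homeomorphism
([limit_set_homeomorphic_boundary]).  If in addition disjoint cells of
level [l] are [C' * rr ^+ l] apart, the first of these two estimates becomes
quantitative too, and the distance of two points is comparable to [rr `^ G],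
with [G] their Gromov product; this is [rho_ext] to the power
[- ln rr / a] ([boundary_hoelder_equivalent]). *)

(** * Euclidean norm, similarities and packing *)

Section EuclideanNorm.
Context {R : realType} {d : nat}.
Implicit Types x y : 'rV[R]_d.

Lemma row_norm_le x (c : R) :
  0 <= c -> (forall i, `|x ord0 i| <= c) -> `|x| <= c.
Proof.
move=> c0 xc; rewrite /Num.norm /= mx_normrE.
by apply/bigmax_leP; split => // -[i j] _ /=; rewrite ord1 xc.
Qed.

Lemma coord_le_norm x i : `|x ord0 i| <= `|x|.
Proof.
rewrite {2}/Num.norm /= mx_normrE.
exact: (le_bigmax _ (fun ij => `|x ij.1 ij.2|) (ord0, i)).
Qed.

Lemma sqr_norm_ge0 x : 0 <= \sum_i x ord0 i ^+ 2.
Proof. by apply: sumr_ge0 => i _; exact: sqr_ge0. Qed.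

Lemma eucl_norm_ge0 x : 0 <= eucl_norm x.
Proof. exact: sqrtr_ge0. Qed.

Lemma eucl_norm_sqr x : eucl_norm x ^+ 2 = \sum_i x ord0 i ^+ 2.
Proof. by rewrite sqr_sqrtr // sqr_norm_ge0. Qed.

Lemma norm_le_eucl_norm x : `|x| <= eucl_norm x.
Proof.
apply: row_norm_le => [|i]; first exact: eucl_norm_ge0.
rewrite -sqrtr_sqr ler_wsqrtr // (bigD1 i) //= lerDl.
by apply: sumr_ge0 => j _; exact: sqr_ge0.
Qed.

Lemma eucl_norm_le_norm x : eucl_norm x <= d%:R * `|x|.
Proof.
have dx0 : 0 <= d%:R * `|x| by rewrite mulr_ge0.
rewrite -(@ler_pXn2r _ 2) ?nnegrE ?eucl_norm_ge0 // eucl_norm_sqr exprMn.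
apply: (@le_trans _ _ (d%:R * `|x| ^+ 2)).
  rewrite mulr_natl -[X in _ *+ X]card_ord -sumr_const ler_sum // => i _.
  by rewrite -real_normK ?num_real // lerXn2r ?nnegrE // coord_le_norm.
by rewrite ler_wpM2r ?sqr_ge0 // -natrX ler_nat; case: (d) => // k; nia.
Qed.

Lemma eucl_norm0 : eucl_norm (0 : 'rV[R]_d) = 0.
Proof.
apply/eqP; rewrite eq_le eucl_norm_ge0 andbT.
by rewrite (le_trans (eucl_norm_le_norm 0)) // normr0 mulr0.
Qed.

Lemma sum_sqrB (u v : 'I_d -> R) :
  \sum_i (u i - v i) ^+ 2 =
    \sum_i u i ^+ 2 + \sum_i v i ^+ 2 - 2 * \sum_i u i * v i.
Proof.
rewrite mulr_sumr -big_split -sumrB; apply: eq_bigr => i _ /=; ring.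
Qed.

(** A similarity is onto: after normalization it fixes the origin and preserves
distances, hence scalar products, so the images of the unit vectors are the
rows of an orthogonal matrix [M]; since the [i]-th coordinate of [x] is the
scalar product of the images of [x] and of the [i]-th unit vector, the
normalized map sends [y *m M^T] to [y]. *)
Lemma similarity_surjective (S : 'rV[R]_d -> 'rV[R]_d) (c : R) : 0 < c ->
  (forall x y, eucl_norm (S x - S y) = c * eucl_norm (x - y)) ->
  forall y, exists x, S x = y.
Proof.
move=> c0 Sc y; pose T x := c^-1 *: (S x - S 0).
have T0 i : T 0 ord0 i = 0 by rewrite /T subrr scaler0 mxE.
have Tdist u v : \sum_i (T u ord0 i - T v ord0 i) ^+ 2 =
    \sum_i (u ord0 i - v ord0 i) ^+ 2.
  have := congr1 (fun t => c^-1 ^+ 2 * t ^+ 2) (Sc u v).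
  rewrite exprMn !eucl_norm_sqr mulrA -exprMn mulVf ?gt_eqF // expr1n mul1r.
  rewrite mulr_sumr => e.
  transitivity (\sum_i (u - v) ord0 i ^+ 2).
    by rewrite -e; apply: eq_bigr => i _; rewrite !mxE; ring.
  by apply: eq_bigr => i _; rewrite !mxE.
have Tsqr u : \sum_i T u ord0 i ^+ 2 = \sum_i u ord0 i ^+ 2.
  have := Tdist u 0.
  under eq_bigr do rewrite T0 subr0.
  by under [RHS]eq_bigr do rewrite mxE subr0.
have Tdot u v : \sum_i T u ord0 i * T v ord0 i = \sum_i u ord0 i * v ord0 i.
  by have := Tdist u v; rewrite !sum_sqrB !Tsqr => e; lra.
pose M := \matrix_(i < d) T (delta_mx ord0 i).
have TM u : T u *m M^T = u.
  apply/rowP => i; rewrite mxE.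
  transitivity (\sum_j u ord0 j * (delta_mx ord0 i : 'rV[R]_d) ord0 j).
    by rewrite -Tdot; apply: eq_bigr => j _; rewrite !mxE.
  rewrite (bigD1 i) //= mxE !eqxx mulr1 big1 ?addr0 // => j ji.
  by rewrite mxE (negbTE ji) andbF mulr0.
have MM : M *m M^T = 1%:M.
  by apply/row_matrixP => i; rewrite row_mul rowK TM row1.
have MinvM z : (z *m M^T) *m M = z.
  by rewrite -mulmxA (mulmx1C MM) mulmx1.
pose z := c^-1 *: (y - S 0).
exists (z *m M^T).
have : T (z *m M^T) = z by rewrite -[LHS]MinvM TM MinvM.
move=> /(scalerI (invr_neq0 (lt0r_neq0 c0))); exact: addIr.
Qed.

End EuclideanNorm.

(** Points of a cube that are separated at scale [s] lie in different cells of
a grid of mesh [s], and the cube has finitely many of these. *)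
Lemma packing (R : realType) (d : nat) (A : R) : exists K : nat,
  forall (T : eqType) (l : seq T) (f : T -> 'rV[R]_d) (p : 'rV[R]_d) (s : R),
    0 < s -> uniq l ->
    (forall x, x \in l -> `|f x - p| <= A * s) ->
    (forall x y, x \in l -> y \in l -> x != y -> s <= `|f x - f y|) ->
    (size l <= K)%N.
Proof.
pose N := Num.truncn (2 * A).
exists #|{ffun 'I_d -> 'I_N.+1}| => T l f p s s0 ul lA lsep.
pose q x i := (f x - p) ord0 i / s + A.
have qbnd x i : x \in l -> 0 <= q x i <= 2 * A.
  move=> /lA /(le_trans (coord_le_norm _ i)).
  rewrite -ler_pdivrMr // -{1}(gtr0_norm s0) -normf_div ler_norml /q.
  by move=> /andP[h1 h2]; apply/andP; split; lra.
pose g x : {ffun 'I_d -> 'I_N.+1} := [ffun i => inord (Num.truncn (q x i))].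
have gq x i : x \in l -> val (g x i) = Num.truncn (q x i).
  move=> xl; rewrite ffunE /= inordK // ltnS.
  by have /andP[q0 qA] := qbnd _ i xl; exact: le_truncn.
have ginj : {in l &, injective g}.
  move=> x y xl yl gxy; apply/eqP/negP => /negP xy.
  have := lsep x y xl yl xy; apply/negP; rewrite -ltNge.
  have [->//|/mx_norm_neq0[[j i]]] := eqVneq `|f x - f y| 0.
  rewrite ord1 /= => fxy; rewrite /Num.norm /= fxy.
  have /andP[qx0 _] := qbnd x i xl; have /andP[qy0 _] := qbnd y i yl.
  have := truncn_itv qy0; have := truncn_itv qx0.
  rewrite -(gq _ _ xl) -(gq _ _ yl) gxy -natr1 => /andP[x1 x2] /andP[y1 y2].
  have -> : (f x - f y) ord0 i = (q x i - q y i) * s.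
    by rewrite /q !mxE; field; rewrite gt_eqF.
  rewrite normrM (gtr0_norm s0) -ltr_pdivlMr // divff ?gt_eqF //.
  by rewrite ltr_norml; apply/andP; split; lra.
have := max_card (mem (map g l)).
by rewrite (card_uniqP _) ?size_map // map_inj_in_uniq.
Qed.

(** * Auxiliary estimates *)

Lemma two_sided_geometric_sum (R : realType) (rr : R) (A n : nat) :
  0 < rr <= 2^-1 -> \sum_(0 <= i < n) rr ^+ (A - i + (i - A)) <= 3.
Proof.
move=> /andP[r0 r2].
(* While the exponents decrease, the partial sum is at most the next term, as
   rr <= 1/2; once they increase, the remainder of the series is at most twice
   its first term. *)
have : \sum_(0 <= i < n) rr ^+ (A - i + (i - A)) <=
    if (n <= A)%N then rr ^+ (A - n) else 3 - 2 * rr ^+ (n - A).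
  elim: n => [|n IH]; first by rewrite big_nil leq0n exprn_ge0 // ltW.
  rewrite big_nat_recr //=; move: IH; case: (ltngtP n A) => [nA|An|->] IH.
  - apply: le_trans (lerD IH (lexx _)) _.
    rewrite (eqP (ltnW nA : n - A == 0)%N) addn0.
    rewrite -[(A - n)%N]prednK ?subn_gt0 // -subnS exprS.
    have := exprn_ge0 (A - n.+1) (ltW r0); nra.
  - apply: le_trans (lerD IH (lexx _)) _.
    rewrite (eqP (ltnW An : A - n == 0)%N) add0n subSn ?(ltnW An) // exprS.
    have := exprn_ge0 (n - A) (ltW r0); nra.
  - apply: le_trans (lerD IH (lexx _)) _.
    rewrite subnn addn0 expr0 subSn // subnn expr1; nra.
move=> /le_trans; apply; case: ifP => _.
  rewrite (@le_trans _ _ 1) ?exprn_ile1 //; lra.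
by rewrite gerBl mulr_ge0 // exprn_ge0 // ltW.
Qed.

Lemma le_truncn_pred (R : realType) (t : R) :
  0 <= t -> t <= (Num.truncn t).-1%:R + 2.
Proof.
move=> /truncn_itv/andP[_].
case: (Num.truncn t) => [|l]; rewrite -natr1 /=; first lra.
by rewrite -natr1 -addrA => /ltW.
Qed.

Lemma limn_einf_ge (R : realType) (u : nat -> \bar R) (c : \bar R) :
  (\forall i \near \oo, (c <= u i)%E) -> (c <= limn_einf u)%E.
Proof.
move=> cu; have -> : limn_einf u = limf_einf u \oo by [].
rewrite limf_einfE.
apply: (@le_trans _ _ (ereal_inf (u @` [set i | (c <= u i)%E]))).
  by apply: le_ereal_inf_tmp => _ [i /= ci <-].
by apply: ereal_sup_ubound; exists [set i | (c <= u i)%E].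
Qed.

Lemma lt_limn_einf (R : realType) (u : nat -> \bar R) (c : \bar R) :
  (c < limn_einf u)%E -> \forall i \near \oo, (c < u i)%E.
Proof.
have -> : limn_einf u = limf_einf u \oo by [].
rewrite limf_einfE => /ereal_sup_gt[_ [A FA <-] cA].
apply: filterS FA => i Ai; apply: lt_le_trans cA _.
by apply: ereal_inf_lbound; exists i.
Qed.

Lemma last_take (T : Type) (x : T) p i : (i <= size p)%N ->
  last x (take i p) = nth x (x :: p) i.
Proof.
move=> ip; rewrite (last_nth x) size_takel //.
by case: i ip => //= i ip; rewrite nth_take.
Qed.

(** * Distance in a graph *)

Section GraphDistance.
Context {V : choiceType} (e : rel V).

Definition walk (k : nat) (x y : V) : Prop :=
  exists p, [/\ path e x p, last x p = y & (size p <= k)%N].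

Lemma walk0 x : walk 0 x x. Proof. by exists [::]. Qed.

Lemma walk_le k m x y : (k <= m)%N -> walk k x y -> walk m x y.
Proof. by move=> km [p [? ? pk]]; exists p; split=> //; lia. Qed.

Lemma walk_trans k m x y z : walk k x y -> walk m y z -> walk (k + m) x z.
Proof.
move=> [p [ep <- pk]] [q [eq <- qm]]; exists (p ++ q).
by rewrite cat_path ep eq last_cat size_cat leq_add.
Qed.

Lemma walk_sym k x y : symmetric e -> walk k x y -> walk k y x.
Proof.
move=> es [p [ep <- pk]]; exists (rev (belast x p)); split.
- by rewrite rev_path; under eq_path do rewrite es.
- by case: p {ep pk} => //= u p; rewrite rev_cons last_rcons.
- by rewrite size_rev size_belast.
Qed.

(** Loops cost nothing: a path of the reflexive closure of the graph shortens
to a path of the graph. *)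
Lemma walk_of_reflexive_path x p :
  path (fun u v => (u == v) || e u v) x p -> walk (size p) x (last x p).
Proof.
elim: p x => [|u p IH] x /=; first by move=> _; exact: walk0.
move=> /andP[/orP[/eqP <-|exu] /IH].
  exact: walk_le.
by move=> w; rewrite -add1n; apply: walk_trans w; exists [:: u]; rewrite /= exu.
Qed.

Context {R : realType}.

Lemma gdist_le k x y : walk k x y -> gdist R e x y <= k%:R.
Proof.
move=> [p [ep py pk]].
apply: (@le_trans _ _ (size p)%:R); last by rewrite ler_nat.
apply: ge_inf; last by exists p.
by exists 0 => _ [q _ <-].
Qed.

Lemma gdist_walk k x y : walk k x y ->
  exists2 N, gdist R e x y = N%:R & walk N x y.
Proof.
move=> w.
have ex : exists N, `[< walk N x y >] by exists k; apply/asboolP.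
case: (ex_minnP ex) => N /asboolP wN minN.
exists N => //; apply/eqP; rewrite eq_le gdist_le //=.
case: (wN) => p [ep py _]; apply: lb_le_inf; first by exists (size p)%:R, p.
move=> _ [q [eq qy] <-]; rewrite ler_nat; apply: minN.
by apply/asboolP; exists q.
Qed.

End GraphDistance.

(** * Hyperbolicity of the augmented tree of a tree of cells *)

(** What hyperbolicity and the boundary depend on: cells shrink by [rr] from one
level to the next, and cells of one level do not pile up.  The latter is
expressed by points [center x] of the cells that are separated at the scale of
the level; distances are measured in the sup norm of ['rV[R]_d]. *)
Record cell_tree (R : realType) (d : nat) (V : choiceType) (e : rel V) (o : V)
    (lev : V -> nat) (anc : nat -> V -> V) (cell : V -> set 'rV[R]_d)
    (center : V -> 'rV[R]_d) (rr D s : R) : Prop := CellTree {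
  ratio_bounds : 0 < rr <= 2^-1;
  diam_gt0 : 0 < D;
  sep_gt0 : 0 < s;
  lev_root : lev o = 0%N;
  lev_anc : forall l x, (l <= lev x)%N -> lev (anc l x) = l;
  anc_id : forall l x, (lev x <= l)%N -> anc l x = x;
  anc_anc : forall l m x, (l <= m)%N -> anc l (anc m x) = anc l x;
  anc_root : forall x, anc 0 x = o;
  edgeP : forall x y, e x y <->
    [\/ lev x = (lev y).+1 /\ anc (lev y) x = y,
        lev y = (lev x).+1 /\ anc (lev x) y = x |
        [/\ x <> y, lev x = lev y & cell x `&` cell y !=set0]];
  cell_anc : forall l x, cell x `<=` cell (anc l x);
  cell_closed : forall x, closed (cell x);
  finite_level : forall l, finite_set [set x | lev x = l];
  cell_diam : forall x z z',
    cell x z -> cell x z' -> `|z - z'| <= D * rr ^+ lev x;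
  center_cell : forall x, cell x (center x);
  center_sep : forall x y,
    x <> y -> lev x = lev y -> s * rr ^+ lev x <= `|center x - center y| }.

Section AugmentedTree.
Context {R : realType} {d : nat} {V : choiceType} {e : rel V} {o : V}
  {lev : V -> nat} {anc : nat -> V -> V} {cell : V -> set 'rV[R]_d}
  {center : V -> 'rV[R]_d} {rr D s : R}.
Hypothesis T : cell_tree e o lev anc cell center rr D s.
Implicit Types (x y : V) (l k N : nat).

Let rr_gt0 : 0 < rr. Proof. by have /andP[] := ratio_bounds T. Qed.

Let D_gt0 : 0 < D. Proof. exact: diam_gt0 T. Qed.

Let rrX_ge0 l : 0 <= rr ^+ l. Proof. by rewrite exprn_ge0 // ltW. Qed.

Let rrX_le l m : (l <= m)%N -> rr ^+ m <= rr ^+ l.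
Proof.
move=> lm; have /andP[_ r2] := ratio_bounds T.
by apply: ler_wiXn2l => //; [exact: ltW | lra].
Qed.

Lemma cell_tree_edge_sym : symmetric e.
Proof.
suff es x y : e x y -> e y x by move=> x y; apply/idP/idP; exact: es.
move=> /(edgeP T) exy; apply/(edgeP T); case: exy => [?|?|[xy ll xz]].
- by constructor 2.
- by constructor 1.
- by constructor 3; split; [exact/nesym | | rewrite setIC].
Qed.

Lemma lev_edge x y : e x y -> (lev x <= (lev y).+1)%N.
Proof. by move=> /(edgeP T)[[-> _]|[-> _]|[_ -> _]] //; lia. Qed.

Lemma lev_path x p : path e x p -> (lev x <= lev (last x p) + size p)%N.
Proof.
elim: p x => [|y p IH] x /=; first by rewrite addn0.
by move=> /andP[/lev_edge exy /IH]; lia.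
Qed.

Lemma lev_last_path x p : path e x p -> (lev (last x p) <= lev x + size p)%N.
Proof.
elim: p x => [|y p IH] x /=; first by rewrite addn0.
by rewrite cell_tree_edge_sym => /andP[/lev_edge exy /IH]; lia.
Qed.

Lemma lev_walk k x y : walk e k x y -> (lev x <= lev y + k)%N.
Proof. by move=> [p [/lev_path + <-]]; lia. Qed.

Lemma walk_anc l x : (l <= lev x)%N -> walk e (lev x - l) x (anc l x).
Proof.
move=> lx; have [k kE] : exists k, k = (lev x - l)%N by exists (lev x - l)%N.
elim: k l lx kE => [|k IH] l lx kE.
  have xl : (lev x <= l)%N by rewrite -subn_eq0 -kE.
  by rewrite (anc_id T xl) -kE; exact: walk0.
have ls : (l.+1 <= lev x)%N by lia.
have w : walk e (lev x - l.+1) x (anc l.+1 x) by apply: IH; lia.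
have -> : (lev x - l = (lev x - l.+1) + 1)%N by lia.
apply: walk_trans w _; exists [:: anc l x]; split=> //=; rewrite andbT.
apply/(edgeP T); constructor 1; rewrite !(lev_anc T) //.
by rewrite (anc_anc T).
Qed.

Lemma walk_anc_anc l k x y : (l <= lev x)%N -> (l <= lev y)%N ->
  walk e k (anc l x) (anc l y) -> walk e (lev x + lev y - l.*2 + k) x y.
Proof.
move=> lx ly w.
have -> : (lev x + lev y - l.*2 + k = (lev x - l) + (k + (lev y - l)))%N by lia.
apply: walk_trans (walk_anc lx) (walk_trans w _).
by apply: walk_sym (walk_anc ly); exact: cell_tree_edge_sym.
Qed.

Lemma connected x y : walk e (lev x + lev y) x y.
Proof.
have := @walk_anc_anc 0 0 x y; rewrite double0 subn0 addn0; apply=> //.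
by rewrite !(anc_root T); exact: walk0.
Qed.

Lemma gdist_nat x y : exists2 N, gdist R e x y = N%:R & walk e N x y.
Proof. exact: gdist_walk (connected x y). Qed.

Lemma gdist_root x : gdist R e o x = (lev x)%:R.
Proof.
apply/eqP; rewrite eq_le; apply/andP; split.
  apply: gdist_le; apply: walk_sym; first exact: cell_tree_edge_sym.
  by have := @walk_anc 0 x; rewrite subn0 (anc_root T); apply.
have [N -> w] := gdist_nat o x; rewrite ler_nat.
by have := lev_walk (walk_sym cell_tree_edge_sym w); rewrite (lev_root T).
Qed.

Local Notation gp := (gromov_prod R e o).

Lemma gromov_prodE x y :
  gp x y = ((lev x)%:R + (lev y)%:R - gdist R e x y) / 2.
Proof. by rewrite /gromov_prod !gdist_root. Qed.

Lemma gromov_prod_ge0 x y : 0 <= gp x y.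
Proof.
rewrite gromov_prodE divr_ge0 // subr_ge0 -natrD.
exact: gdist_le (connected x y).
Qed.

Lemma gromov_prod_le_lev x y : gp x y <= (lev x)%:R.
Proof.
have [N + w] := gdist_nat x y; rewrite gromov_prodE => ->.
have := lev_walk (walk_sym cell_tree_edge_sym w).
rewrite -(ler_nat R) natrD; lra.
Qed.

Lemma gromov_prod_diag x : gp x x = (lev x)%:R.
Proof.
apply/eqP; rewrite eq_le gromov_prod_le_lev gromov_prodE.
have g0 : gdist R e x x <= 0%:R by apply: gdist_le; exact: walk0.
lra.
Qed.

(** The path that climbs from [x] to level [l], crosses to the ancestor of [y]
and climbs down has length [lev x + lev y - 2 l + k]. *)
Lemma gromov_prod_ge l k x y : (l <= lev x)%N -> (l <= lev y)%N ->
  walk e k (anc l x) (anc l y) -> l%:R - k%:R <= gp x y.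
Proof.
move=> lx ly w; have := gdist_le (walk_anc_anc lx ly w) (R := R).
have -> : (lev x + lev y - l.*2 + k)%:R =
    (lev x)%:R + (lev y)%:R - 2 * l%:R + k%:R :> R.
  by rewrite natrD natrB ?natrD -?mul2n ?natrM //; lia.
rewrite gromov_prodE; have := ler0n R k; lra.
Qed.

Lemma gromov_prod_ge_of_meet l x y : (l <= lev x)%N -> (l <= lev y)%N ->
  cell (anc l x) `&` cell (anc l y) !=set0 -> l%:R - 1 <= gp x y.
Proof.
move=> lx ly xy; apply: (@gromov_prod_ge l 1) => //.
have [->|/eqP xny] := eqVneq (anc l x) (anc l y).
  exact: walk_le (walk0 _ _).
exists [:: anc l y]; split=> //=; rewrite andbT.
by apply/(edgeP T); constructor 3; split=> //; rewrite !(lev_anc T).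
Qed.

Lemma walk_of_le_gromov_prod l x y : l%:R <= gp x y ->
  exists2 N, walk e N x y & (l.*2 + N <= lev x + lev y)%N.
Proof.
have [N + w] := gdist_nat x y; rewrite gromov_prodE => -> h.
by exists N => //; rewrite -(ler_nat R) !natrD -addnn natrD; lra.
Qed.

(** Along an edge, vertical or horizontal, the two cells meet. *)
Lemma path_spread x p z z' : path e x p -> cell x z -> cell (last x p) z' ->
  `|z - z'| <= D * \sum_(v <- x :: p) rr ^+ lev v.
Proof.
elim: p x z => [|u p IH] x z.
  by move=> _ xz xz'; rewrite big_seq1; exact: (cell_diam T).
rewrite big_cons mulrDr => /= /andP[exu up] xz pz'.
have [q [xq uq]] : cell x `&` cell u !=set0.
  case/(edgeP T): exu => [[_ xu]|[_ ux]|[]//].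
  - by exists z; split=> //; rewrite -xu; exact: (cell_anc T).
  - exists (center u); split; last exact: (center_cell T).
    by rewrite -ux; apply: (cell_anc T); exact: (center_cell T).
rewrite -(subrKA q); apply: le_trans (ler_normD _ _) _.
by rewrite lerD //; [exact: (cell_diam T) | exact: IH].
Qed.

Lemma lev_along_path x p l i : path e x p -> (i <= size p)%N ->
  (l.*2 + size p <= lev x + lev (last x p))%N ->
  (l + (lev x - l - i + (i - (lev x - l))) <= lev (last x (take i p)))%N.
Proof.
move=> ep ip; have := ep; rewrite -{1}(cat_take_drop i p) cat_path.
move=> /andP[/lev_path p1 /lev_last_path]; rewrite -last_cat cat_take_drop.
by move: p1; rewrite size_drop size_takel //; lia.
Qed.

(** The vertices of a path that is shorter than [lev x + lev y - 2 l] stay below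
level [l], and go deeper the farther they are from the middle; the diameters
of their cells add up to a convergent geometric series. *)
Lemma short_path_spread x p l i z z' : path e x p -> (i <= size p)%N ->
  (l.*2 + size p <= lev x + lev (last x p))%N ->
  cell x z -> cell (last x (take i p)) z' -> `|z - z'| <= 3 * D * rr ^+ l.
Proof.
move=> ep ip lp xz iz'.
have := path_spread (take_path i ep) xz iz'; move/le_trans; apply.
rewrite [3 * D]mulrC -mulrA ler_pM2l ?D_gt0 //.
rewrite (big_nth x) /= (size_takel ip).
apply: (@le_trans _ _ (\sum_(0 <= j < i.+1)
    rr ^+ (lev x - l - j + (j - (lev x - l))) * rr ^+ l)); last first.
  rewrite -mulr_suml ler_wpM2r ?rrX_ge0 //.
  exact: two_sided_geometric_sum (ratio_bounds T).
rewrite big_nat [leRHS]big_nat; apply: ler_sum => j /andP[_ ji].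
rewrite -exprD rrX_le // addnC.
have -> : nth x (x :: take i p) j = last x (take j p).
  rewrite last_take ?(leq_trans _ ip) //.
  by case: j ji => //= j ji; rewrite nth_take.
apply: lev_along_path => //; exact: leq_trans (ji : (j <= i)%N) ip.
Qed.

Lemma walk_spread l N x y z z' : walk e N x y ->
  (l.*2 + N <= lev x + lev y)%N -> cell x z -> cell y z' ->
  `|z - z'| <= 3 * D * rr ^+ l.
Proof.
move=> [p [ep py pN]] lN xz yz'; rewrite -py in yz' lN.
apply: (short_path_spread ep (leqnn _)) => //; last by rewrite take_size.
by apply: leq_trans lN; rewrite leq_add2l.
Qed.

(** Cells that meet have ancestors whose cells meet. *)
Lemma edge_anc l x y : e x y -> (l <= lev x)%N -> (l <= lev y)%N ->
  (anc l x == anc l y) || e (anc l x) (anc l y).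
Proof.
move=> /(edgeP T)[[_ yE]|[_ xE]|[_ xy [z [xz yz]]]] lx ly.
- by rewrite -[in anc l y]yE (anc_anc T) ?eqxx.
- by rewrite -[in anc l x]xE (anc_anc T) ?eqxx.
- case: eqVneq => //= /eqP lxy; apply/(edgeP T); constructor 3.
  by split; rewrite ?(lev_anc T) //; exists z; split; exact: (cell_anc T).
Qed.

(** The heart of the hyperbolicity: seen from level [l], a path that is shorter
than [lev x + lev y - 2 l] visits boundedly many cells, because they all lie
within a bounded multiple of [rr ^+ l] from each other while their centers are
separated at that scale. *)
Lemma walk_anc_of_short_walk : exists K : nat, forall l N x y,
  walk e N x y -> (l.*2 + N <= lev x + lev y)%N ->
  [/\ (l <= lev x)%N, (l <= lev y)%N & walk e K (anc l x) (anc l y)].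
Proof.
have [K packK] := packing d (4 * D / s).
exists K => l N x y [p [ep py pN]] lN.
have lp : (l.*2 + size p <= lev x + lev (last x p))%N.
  by rewrite py; apply: leq_trans lN; rewrite leq_add2l.
have le_lev i : (i <= size p)%N -> (l <= lev (last x (take i p)))%N.
  by move=> ip; apply: leq_trans (lev_along_path ep ip lp); exact: leq_addr.
split; first by have := le_lev 0%N (leq0n _); rewrite take0.
  by have := le_lev _ (leqnn _); rewrite take_size py.
have in_path v : v \in x :: p ->
    exists2 i, (i <= size p)%N & v = last x (take i p).
  move=> vp; exists (index v (x :: p)); first by rewrite -ltnS index_mem.
  by rewrite last_take ?nth_index // -ltnS index_mem.
have lev_p v : v \in x :: p -> (l <= lev v)%N.
  by move=> /in_path[i ip ->]; exact: le_lev.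
have spread v : v \in x :: p -> `|center v - center x| <= 3 * D * rr ^+ l.
  move=> /in_path[i ip ->]; rewrite distrC.
  by apply: (short_path_spread ep ip lp); exact: (center_cell T).
have -> : anc l y = last (anc l x) (map (anc l) p) by rewrite last_map py.
have : path (fun u v => (u == v) || e u v) (anc l x) (map (anc l) p).
  apply/(pathP (anc l x)) => i; rewrite size_map => ip.
  rewrite -(map_cons (anc l) x p) !(nth_map x) //; last exact: leqW.
  apply: edge_anc; first exact: (pathP x ep).
    by apply: lev_p; rewrite mem_nth //= leqW.
  by apply: lev_p; rewrite in_cons mem_nth ?orbT.
case/shortenP => q eq uq qp.
apply: walk_le (walk_of_reflexive_path eq).
have qP v : v \in anc l x :: q -> exists2 w, w \in x :: p & v = anc l w.
  rewrite in_cons => /orP[/eqP ->|/qp /mapP[w wp ->]].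
    by exists x; rewrite // mem_head.
  by exists w; rewrite // in_cons wp orbT.
apply: ltnW; apply: (packK _ _ center (center x) (s * rr ^+ l) _ uq).
- by rewrite mulr_gt0 ?exprn_gt0 //; exact: (sep_gt0 T).
- move=> _ /qP[w wp ->]; rewrite mulrA divfK ?gt_eqF ?(sep_gt0 T) //.
  have := spread w wp.
  have : `|center (anc l w) - center w| <= D * rr ^+ l.
    rewrite -[in rr ^+ l](lev_anc T (lev_p w wp)).
    apply: (cell_diam T); first exact: (center_cell T).
    by apply: (cell_anc T); exact: (center_cell T).
  move=> h1 h2; rewrite -(subrKA (center w)).
  by apply: le_trans (ler_normD _ _) _; lra.
- move=> _ _ /qP[w wp ->] /qP[w' wp' ->] /eqP ww.
  rewrite -[in rr ^+ l](lev_anc T (lev_p w wp)).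
  by apply: (center_sep T) => //; rewrite !(lev_anc T) ?lev_p.
Qed.

Theorem cell_tree_hyperbolic : hyperbolic R e o.
Proof.
have [K walkK] := walk_anc_of_short_walk.
exists (K + K + 1)%:R; first by rewrite ltr0n addn1.
move=> x y z; pose m := Num.min (gp x z) (gp z y).
have m0 : 0 <= m by rewrite le_min !gromov_prod_ge0.
have /andP[lm ml] := truncn_itv m0; set l := Num.truncn m in lm ml *.
have /andP[lxz lzy] : (l%:R <= gp x z) && (l%:R <= gp z y).
  by rewrite -le_min.
have [N w Nl] := walk_of_le_gromov_prod lxz.
have [lx lz w1] := walkK _ _ _ _ w Nl.
have [M w' Ml] := walk_of_le_gromov_prod lzy.
have [_ ly w2] := walkK _ _ _ _ w' Ml.
have := gromov_prod_ge lx ly (walk_trans w1 w2).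
move=> h; apply: le_trans h; rewrite -/m [in leLHS]natrD.
by move: ml; rewrite -natr1; lra.
Qed.

(** * Sequences of vertices tending to a point *)

Lemma gromov_prodC x y : gp x y = gp y x.
Proof.
have gdist_sym u v : gdist R e u v <= gdist R e v u.
  have [N -> w] := gdist_nat v u; apply: gdist_le.
  by apply: walk_sym w; exact: cell_tree_edge_sym.
rewrite !gromov_prodE [X in X - _]addrC; congr ((_ - _) / 2).
by apply/eqP; rewrite eq_le !gdist_sym.
Qed.

Lemma gromov_prod_spread l x y z z' : l%:R <= gp x y ->
  cell x z -> cell y z' -> `|z - z'| <= 3 * D * rr ^+ l.
Proof. by move=> /walk_of_le_gromov_prod[N w lN]; exact: walk_spread w lN. Qed.

Lemma rrX_small (C eps : R) : 0 < eps -> exists l, C * rr ^+ l < eps.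
Proof.
move=> eps0; have rr1 : `|rr| < 1.
  by rewrite gtr0_norm //; have /andP[_ r2] := ratio_bounds T; lra.
have : C * rr ^+ l @[l --> \oo] --> 0.
  by rewrite -(mulr0 C); apply: cvgMr; exact: cvg_expr.
move=> /cvgr0Pnorm_lt/(_ _ eps0)[l _ /(_ _ (leqnn l)) Cl].
by exists l; exact: le_lt_trans (ler_norm _) Cl.
Qed.

(** Finitely many closed cells have level [l], so a point that is not in one of
them is at a positive distance from it, uniformly. *)
Lemma near_level z l : exists2 eps : R, 0 < eps &
  forall x z', lev x = l -> cell x z' -> `|z - z'| < eps -> cell x z.
Proof.
pose far := \bigcup_(x in [set x | lev x = l /\ ~ cell x z]) cell x.
have : closed far.
  apply: closed_bigcup; last by move=> x _; exact: (cell_closed T).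
  by apply: sub_finite_set (finite_level T l) => x [].
move=> /closed_openC; rewrite openE => /(_ z) farz.
have /farz/nbhs_ballP[eps /= eps0 far_eps] : (~` far) z by move=> [x [_ xz]].
exists eps => // x z' xl xz' zz'; apply: contrapT => xz.
by apply: (far_eps z'); [rewrite -ball_normE | exists x].
Qed.

(** Convergence in the completion, expressed through the tree: for vertices that
tend to the boundary it is equivalent to convergence of their cells to [z]
([tends_to_of_centers]). *)
Definition tends_to (u : nat -> V) (z : 'rV[R]_d) : Prop :=
  forall l, \forall i \near \oo, (l <= lev (u i))%N /\ cell (anc l (u i)) z.

Definition limit_set : set 'rV[R]_d :=
  \bigcap_l \bigcup_(x in [set x | lev x = l]) cell x.

Definition escapes (u : nat -> V) : Prop :=
  forall l, \forall i \near \oo, (l <= lev (u i))%N.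

Lemma tends_to_escapes u z : tends_to u z -> escapes u.
Proof. by move=> uz l; apply: filterS (uz l) => i []. Qed.

Lemma tends_to_limit_set u z : tends_to u z -> limit_set z.
Proof.
move=> uz l _; have [N _ /(_ N (leqnn N)) [lN zN]] := uz l.
by exists (anc l (u N)) => //=; rewrite (lev_anc T).
Qed.

Lemma limit_set_tends_to z : limit_set z ->
  exists u, tends_to u z /\ forall i, lev (u i) = i /\ cell (u i) z.
Proof.
move=> Ez; have /choice[u uP] : forall i, exists x, lev x = i /\ cell x z.
  by move=> i; have [x /= xi xz] := Ez i I; exists x.
exists u; split=> // l; exists l => // i /= li.
have [ui uz] := uP i; split; first by rewrite ui.
exact: (cell_anc T).
Qed.

(** A cell that comes close to [z] has ancestors of level [l] whose cells come
close to [z], so contain it by [near_level]. *)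
Lemma tends_to_of_centers u z : escapes u ->
  (forall eps, 0 < eps -> \forall i \near \oo, `|z - center (u i)| < eps) ->
  tends_to u z.
Proof.
move=> u_esc uz l; have [eps eps0 near] := near_level z l.
apply: filterS2 (u_esc l) (uz _ eps0) => i li ui; split=> //.
apply: near ui; first by rewrite (lev_anc T).
by apply: (cell_anc T); exact: (center_cell T).
Qed.

Lemma tends_to_center u z l : tends_to u z ->
  \forall i \near \oo, `|z - center (u i)| <= D * rr ^+ l.
Proof.
move=> /(_ l); apply: filterS => i [li zi].
rewrite -[in rr ^+ l](lev_anc T li); apply: (cell_diam T) zi _.
by apply: (cell_anc T); exact: (center_cell T).
Qed.

Lemma tends_to_gromov_prod u v z l : tends_to u z -> tends_to v z ->
  exists N, forall i j, (N <= i)%N -> (N <= j)%N -> l%:R <= gp (u i) (v j).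
Proof.
move=> /(_ l.+1)[N _ uN] /(_ l.+1)[M _ vM].
exists (maxn N M) => i j; rewrite !geq_max => /andP[Ni _] /andP[_ Mj].
have [ui uz] := uN i Ni; have [vj vz] := vM j Mj.
have := gromov_prod_ge_of_meet ui vj (ex_intro _ z (conj uz vz)).
by rewrite -natr1 addrK.
Qed.

(** [3 * D * rr ^+ l] between the centers of the cells, and [D * rr ^+ l] from
each limit point to the center next to it. *)
Lemma tends_to_dist u v z z' l : tends_to u z -> tends_to v z' ->
  (\forall i \near \oo, l%:R <= gp (u i) (v i)) ->
  `|z - z'| <= 5 * D * rr ^+ l.
Proof.
move=> /tends_to_center-/(_ l) uz /tends_to_center-/(_ l) vz uv.
have [N _ /(_ N (leqnn N)) [[h1 h2] h3]] := filterI (filterI uz vz) uv.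
have h4 := gromov_prod_spread h3 (center_cell T _) (center_cell T _).
have e1 := ler_normD (z - center (u N)) (center (u N) - z').
have e2 := ler_normD (center (u N) - center (v N)) (center (v N) - z').
rewrite subrKA in e1; rewrite subrKA in e2.
by move: e1 e2 h1 h2 h4; rewrite [`|center (v N) - z'|]distrC /=; lra.
Qed.

Lemma tends_to_unique u z z' : tends_to u z -> tends_to u z' -> z = z'.
Proof.
move=> uz uz'; apply/eqP; rewrite -subr_eq0 -normr_le0.
apply/ler_addgt0Pr => eps eps0; have [l lE] := rrX_small (5 * D) eps0.
rewrite add0r (le_trans _ (ltW lE)) //; apply: (tends_to_dist uz uz').
apply: filterS (tends_to_escapes uz l) => i.
by rewrite gromov_prod_diag ler_nat.
Qed.

(** * The completion and its boundary *)

Section Boundary.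
Variable a : R.
Hypothesis a_gt0 : 0 < a.

Local Notation rho := (rho e o a).
Local Notation rho_cauchy := (rho_cauchy e o a).
Local Notation cauchy_class := (cauchy_class e o a).
Local Notation completion := (completion e o a).
Local Notation boundary := (hyp_boundary e o a).
Local Notation gp_ext := (@gromov_prod_ext R V e o a).

Lemma rho_ge0 x y : 0 <= rho x y.
Proof. by rewrite /Defs.rho; case: ifP => // _; exact: expR_ge0. Qed.

Lemma gromov_prod_of_rho l x y : rho x y < expR (- a * l%:R) ->
  x = y \/ l%:R < gp x y.
Proof.
rewrite /Defs.rho; case: eqVneq => [->|_]; first by left.
by rewrite ltr_expR !mulNr ltrN2 ltr_pM2l //; right.
Qed.

Lemma gromov_prod_of_rho_escaping l x y : (l <= lev x)%N ->
  rho x y < expR (- a * l%:R) -> l%:R <= gp x y.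
Proof.
move=> lx /gromov_prod_of_rho[<-|/ltW//].
by rewrite gromov_prod_diag ler_nat.
Qed.

Lemma rho_eq_of_shallow l x y : (lev x <= l)%N ->
  rho x y < expR (- a * l%:R) -> x = y.
Proof.
move=> xl /gromov_prod_of_rho[//|].
move=> /lt_le_trans/(_ (gromov_prod_le_lev _ _)).
by rewrite ltr_nat ltnNge xl.
Qed.

Lemma expR_small (eps : R) : 0 < eps ->
  exists l : nat, forall t, l%:R <= t -> expR (- a * t) < eps.
Proof.
move=> eps0; exists (Num.truncn `|ln eps / a|).+1 => t /(lt_le_trans _) lt.
have := lt _ (truncnS_gt _) => {}lt.
rewrite -[ltRHS]lnK ?posrE // ltr_expR mulNr ltrNl.
have : - (ln eps / a) < t by rewrite (le_lt_trans _ lt) // -normrN ler_norm.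
by rewrite -mulNr ltr_pdivrMr // mulrC.
Qed.

Lemma rho_small (eps : R) : 0 < eps ->
  exists l : nat, forall x y, l%:R <= gp x y -> rho x y < eps.
Proof.
move=> eps0; have [l lP] := expR_small eps0; exists l => x y lxy.
by rewrite /Defs.rho; case: ifP => // _; exact: lP.
Qed.

Lemma tends_to_cauchy u z : tends_to u z -> rho_cauchy u.
Proof.
move=> uz eps /rho_small[l lP].
have [N uN] := tends_to_gromov_prod l uz uz.
by exists N => i j Ni Nj; exact/lP/uN.
Qed.

Lemma cvg_rho0P (u v : nat -> V) : rho (u i) (v i) @[i --> \oo] --> 0 <->
  forall eps, 0 < eps -> \forall i \near \oo, rho (u i) (v i) < eps.
Proof.
split=> [/cvgr0Pnorm_lt uv eps /uv|uv].
  by apply: filterS => i; exact: le_lt_trans (ler_norm _).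
apply/cvgr0Pnorm_lt => eps /uv; apply: filterS => i.
by rewrite ger0_norm ?rho_ge0.
Qed.

(** Sequences that tend to the same point have ancestors of any given level
whose cells share that point, so their Gromov products grow; conversely, when the
Gromov products of two sequences grow, their cells get close to each other. *)
Lemma cauchy_class_tends_to u z : tends_to u z ->
  cauchy_class u = [set v | tends_to v z].
Proof.
move=> uz; apply/seteqP; split=> v /=.
  move=> [_ /cvg_rho0P uv].
  have close l : \forall i \near \oo, l%:R <= gp (u i) (v i).
    have := uv _ (expR_gt0 (- a * l%:R)).
    apply: filterS2 (tends_to_escapes uz l) => i.
    exact: gromov_prod_of_rho_escaping.
  apply: tends_to_of_centers => [l|eps eps0].
    apply: filterS (close l) => i; rewrite gromov_prodC => /le_trans.
    by move=> /(_ _ (gromov_prod_le_lev _ _)); rewrite ler_nat.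
  have [l lE] := rrX_small (4 * D) eps0.
  apply: filterS2 (tends_to_center l uz) (close l) => i ui ci.
  have := gromov_prod_spread ci (center_cell T _) (center_cell T _).
  have := ler_normD (z - center (u i)) (center (u i) - center (v i)).
  by rewrite subrKA; lra.
move=> vz; split; first exact: tends_to_cauchy vz.
apply/cvg_rho0P => eps /rho_small[l lP].
have [N uvN] := tends_to_gromov_prod l uz vz.
by exists N => // i /= Ni; apply/lP/uvN.
Qed.

(** The Gromov product with a vertex is at most its level, so a term of bounded
level, far enough in a Cauchy sequence, equals all the later ones. *)
Lemma cauchy_escapes_or_constant u : rho_cauchy u ->
  escapes u \/ exists x, \forall i \near \oo, u i = x.
Proof.
move=> cu; have [|/existsNP[l ul]] := pselect (escapes u); [by left | right].
have [N uN] := cu _ (expR_gt0 (- a * l%:R)).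
have [i [Ni il]] : exists i, (N <= i)%N /\ (lev (u i) < l)%N.
  apply: contrapT => /forallNP Hi; apply: ul; exists N => // i /= Ni.
  by rewrite leqNgt; apply/negP => il; apply: (Hi i).
exists (u i); exists N => // j /= Nj; apply/esym.
exact: rho_eq_of_shallow (ltnW il) (uN _ _ Ni Nj).
Qed.

(** Large Gromov products make the centers of the cells a Cauchy sequence, and
its limit is the point looked for. *)
Lemma escaping_cauchy_tends_to u : rho_cauchy u -> escapes u ->
  exists z, tends_to u z.
Proof.
move=> cu u_esc.
have close l : exists N, forall i j, (N <= i)%N -> (N <= j)%N ->
    l%:R <= gp (u i) (u j).
  have [N uN] := cu _ (expR_gt0 (- a * l%:R)); have [M _ lM] := u_esc l.
  exists (maxn N M) => i j; rewrite !geq_max => /andP[Ni Mi] /andP[Nj _].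
  by apply: gromov_prod_of_rho_escaping; [exact: lM | exact: uN].
have : cauchy (center (u i) @[i --> \oo]).
  apply/cauchy_exP => eps eps0.
  have [l lE] := rrX_small (3 * D) eps0; have [N uN] := close l.
  exists (center (u N)); exists N => // i /= Ni; rewrite -ball_normE /=.
  apply: le_lt_trans lE; apply: (gromov_prod_spread (uN _ _ (leqnn N) Ni));
    exact: (center_cell T).
move=> /cauchy_cvg/cvg_ex[z /cvgrPdist_lt uz].
by exists z; exact: tends_to_of_centers.
Qed.

Lemma completion_ext (xi eta : completion) : sval xi = sval eta -> xi = eta.
Proof. by apply: eq_sig_hprop => C; exact: Prop_irrelevance. Qed.

Lemma cauchy_class_near_const (u : nat -> V) x :
  (\forall i \near \oo, u i = x) -> cauchy_class u = cauchy_class (fun=> x).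
Proof.
move=> ux; apply/seteqP; split=> v [cv /cvg_rho0P uv]; split=> //;
  apply/cvg_rho0P => eps eps0; apply: filterS2 ux (uv _ eps0) => i -> //.
Qed.

Definition represents (z : 'rV[R]_d) (xi : completion) : Prop :=
  sval xi = [set v | tends_to v z].

Lemma represents_inj z xi eta : represents z xi -> represents z eta -> xi = eta.
Proof. by move=> xiz etaz; apply: completion_ext; rewrite xiz etaz. Qed.

Lemma boundary_represented xi : boundary xi ->
  exists2 z, limit_set z & represents z xi.
Proof.
case: xi => C CP /= bxi; have [u cu CE] := CP.
have u_esc : escapes u.
  have [//|[x ux]] := cauchy_escapes_or_constant cu; exfalso; apply: bxi.
  exists x => //; apply: completion_ext.
  by rewrite /= CE (cauchy_class_near_const ux).
have [z uz] := escaping_cauchy_tends_to cu u_esc.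
exists z; first exact: tends_to_limit_set uz.
by rewrite /represents /= CE (cauchy_class_tends_to uz).
Qed.

Lemma limit_set_represents z : limit_set z ->
  exists2 xi, boundary xi & represents z xi.
Proof.
move=> /limit_set_tends_to[u [uz _]].
pose xi : completion := exist _ (cauchy_class u)
  (ex_intro2 _ _ u (tends_to_cauchy uz) erefl).
exists xi; last exact: cauchy_class_tends_to.
move=> [x _ /(congr1 sval)/= xu].
have : cauchy_class u u by rewrite (cauchy_class_tends_to uz).
rewrite -xu => -[_ /cvg_rho0P/(_ _ (expR_gt0 (- a * (lev x)%:R)))[N _ xuN]].
have [M _ uM] := tends_to_escapes uz (lev x).+1.
have := uM _ (leq_maxr N M); rewrite /=.
by rewrite -(rho_eq_of_shallow (leqnn _) (xuN _ (leq_maxl N M))) ltnn.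
Qed.

Lemma represents_fun xi z z' : represents z xi -> represents z' xi -> 
  boundary xi -> z = z'.
Proof.
move=> xiz xiz' /boundary_represented[w /limit_set_tends_to[u [uw _]] xiw].
have xiu : sval xi u by rewrite xiw.
apply: (@tends_to_unique u); first by move: xiu; rewrite xiz.
by move: xiu; rewrite xiz'.
Qed.

Lemma gromov_prod_ext_ge (c : R) xi eta u v : sval xi u -> sval eta v ->
  (\forall i \near \oo, c <= gp (u i) (v i)) -> (c%:E <= gp_ext xi eta)%E.
Proof.
move=> xiu etav uv.
apply: (@le_trans _ _ (limn_einf (fun i => (gp (u i) (v i))%:E))).
  by apply: limn_einf_ge; apply: filterS uv => i; rewrite lee_fin.
by apply: ereal_sup_ubound; exists u => //; exists v.
Qed.

Lemma lt_gromov_prod_ext (c : R) xi eta : (c%:E < gp_ext xi eta)%E ->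
  exists u v, [/\ sval xi u, sval eta v &
    \forall i \near \oo, c < gp (u i) (v i)].
Proof.
move=> /ereal_sup_gt[_ [u xiu [v etav <-]] /lt_limn_einf uv].
by exists u, v; split=> //; apply: filterS uv => i; rewrite lte_fin.
Qed.

Section TwoPoints.
Variables (z z' : 'rV[R]_d) (xi eta : completion).
Hypotheses (xiz : represents z xi) (etaz' : represents z' eta).
Hypotheses (Ez : limit_set z) (Ez' : limit_set z').

Lemma dist_le_of_gromov_prod_ext l : (l%:R%:E < gp_ext xi eta)%E ->
  `|z - z'| <= 5 * D * rr ^+ l.
Proof.
move=> /lt_gromov_prod_ext[u [v []]]; rewrite xiz etaz' => uz vz' uv.
by apply: (tends_to_dist uz vz'); apply: filterS uv => i /ltW.
Qed.

Lemma gromov_prod_ext_ge0 : (0 <= gp_ext xi eta)%E.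
Proof.
have [u [uz _]] := limit_set_tends_to Ez.
have [v [vz _]] := limit_set_tends_to Ez'.
apply: (@gromov_prod_ext_ge 0 _ _ u v); rewrite ?xiz ?etaz' //.
by near=> i; exact: gromov_prod_ge0.
Unshelve. all: by end_near. Qed.

Lemma gromov_prod_ext_ge_of_meet l :
  (forall x y, lev x = l -> lev y = l -> cell x z -> cell y z' ->
    cell x `&` cell y !=set0) ->
  ((l%:R - 1)%:E <= gp_ext xi eta)%E.
Proof.
move=> meet.
have [u [uz uE]] := limit_set_tends_to Ez.
have [v [vz vE]] := limit_set_tends_to Ez'.
apply: (@gromov_prod_ext_ge _ _ _ u v); rewrite ?xiz ?etaz' //.
exists l => // i /= li; have [ui uzi] := uE i; have [vi vzi] := vE i.
apply: gromov_prod_ge_of_meet; rewrite ?ui ?vi //.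
apply: meet; rewrite ?(lev_anc T) ?ui ?vi //; exact: (cell_anc T).
Qed.

(** If the product were infinite, the two points would be at distance at most
[5 * D * rr ^+ l] for all [l]. *)
Lemma gromov_prod_ext_fin_num : xi <> eta -> gp_ext xi eta \is a fin_num.
Proof.
move=> xieta; rewrite ge0_fin_numE ?gromov_prod_ext_ge0 // ltey.
apply/eqP => gpy; apply: xieta; apply: represents_inj xiz _.
suff -> : z = z' by [].
apply/eqP; rewrite -subr_eq0 -normr_le0; apply/ler_addgt0Pr => eps eps0.
have [l lE] := rrX_small (5 * D) eps0.
rewrite add0r (le_trans _ (ltW lE)) //.
by apply: dist_le_of_gromov_prod_ext; rewrite gpy ltry.
Qed.

End TwoPoints.

Local Notation rho_ext := (@rho_ext R V e o a).

(** Vertices are isolated in the completion, because the Gromov product with a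
vertex is at most its level. *)
Lemma embed_isolated x eta :
  rho_ext (embed e o a x) eta < expR (- a * (lev x)%:R) -> eta = embed e o a x.
Proof.
rewrite /Defs.rho_ext; case: eqVneq => [<-//|_].
rewrite ltr_expR !mulNr ltrN2 ltr_pM2l // => xlt; exfalso.
have gle : (gp_ext (embed e o a x) eta <= (lev x)%:R%:E)%E.
  rewrite leNgt; apply/negP => /lt_gromov_prod_ext[u [v []]] /=.
  move=> [_ /cvg_rho0P/(_ _ (expR_gt0 (- a * (lev x)%:R))) xu] _ uv.
  have [N _ /(_ N (leqnn N)) [h1 h2]] := filterI xu uv.
  move: h2; rewrite -(rho_eq_of_shallow (leqnn _) h1); apply/negP.
  by rewrite -leNgt gromov_prod_le_lev.
move: gle xlt; case: (gp_ext _ _) => [t| |] //=.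
  by rewrite lee_fin => /le_lt_trans h /h; rewrite ltxx.
by rewrite ltNge ler0n.
Qed.

(** The cells through [z] and through [z'] at level [l] meet as soon as [z] and
[z'] are close, by [near_level]; so this is the continuity of the map from the
limit set to the boundary. *)
Lemma rho_ext_small (eps : R) : 0 < eps -> exists l : nat,
  forall z z' xi eta, represents z xi -> represents z' eta ->
    limit_set z -> limit_set z' ->
    (forall x y, lev x = l -> lev y = l -> cell x z -> cell y z' ->
      cell x `&` cell y !=set0) -> rho_ext xi eta < eps.
Proof.
move=> eps0; have [l lP] := expR_small eps0; exists l.+1.
move=> z z' xi eta xiz etaz Ez Ez' meet.
rewrite /Defs.rho_ext; case: eqVneq => // /eqP xieta; apply: lP.
have := gromov_prod_ext_ge_of_meet xiz etaz Ez Ez' meet.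
rewrite -natr1 addrK -lee_fin fineK //.
exact: gromov_prod_ext_fin_num xiz etaz Ez Ez' xieta.
Qed.

Lemma rho_ext_controls_dist (eps : R) : 0 < eps -> exists2 del : R, 0 < del &
  forall z z' xi eta, represents z xi -> represents z' eta ->
    limit_set z -> limit_set z' -> boundary xi ->
    rho_ext xi eta < del -> `|z - z'| < eps.
Proof.
move=> eps0; have [l lE] := rrX_small (5 * D) eps0.
exists (expR (- a * l%:R)) => [|z z' xi eta xiz etaz Ez Ez' bxi].
  exact: expR_gt0.
rewrite /Defs.rho_ext; case: eqVneq => [xieta _|/eqP xieta].
  rewrite -xieta in etaz.
  by rewrite (represents_fun xiz etaz bxi) subrr normr0.
rewrite ltr_expR !mulNr ltrN2 ltr_pM2l // => lg.
apply: le_lt_trans lE; apply: (dist_le_of_gromov_prod_ext xiz etaz).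
rewrite -[gp_ext _ _]fineK ?lte_fin //.
exact: gromov_prod_ext_fin_num xiz etaz Ez Ez' xieta.
Qed.

(** * The boundary and the limit set *)

(** The homeomorphism sends [z] to the class of the sequences that tend to [z].
Its inverse is continuous for the topology induced by the completion: the
vertices being isolated, adding all of them to the preimage of an open set
makes it open in the completion. *)
Theorem limit_set_homeomorphic_boundary : homeomorphic limit_set boundary.
Proof.
have /choice[f fP] : forall z : limit_set,
    exists xi : boundary, represents (val z) (val xi).
  move=> [z Ez]; have [xi bxi xiz] := limit_set_represents (set_mem Ez).
  by exists (exist _ xi (mem_set bxi)).
have /choice[g gP] : forall xi : boundary,
    exists z : limit_set, represents (val z) (val xi).
  move=> [xi bxi]; have [z Ez xiz] := boundary_represented (set_mem bxi).
  by exists (exist _ z (mem_set Ez)).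
have limP (z : limit_set) : limit_set (val z) by exact: set_mem (valP z).
have bndP (xi : boundary) : Defs.hyp_boundary e o a (val xi).
  exact: set_mem (valP xi).
exists f, g; split.
- move=> z; apply: val_inj.
  by apply: (represents_fun (gP _) (fP _)); exact: bndP.
- by move=> xi; apply: val_inj; exact: (represents_inj (fP _) (gP _)).
- apply: continuous_comp_initial => z U.
  rewrite nbhsE => -[W [oW Wz] WU].
  suff nzW : nbhs z [set y | W (val (f y))] by apply: filterS nzW => y /WU.
  have [eps eps0 Weps] := oW _ Wz; have [l lP] := rho_ext_small eps0.
  have [del del0 near] := near_level (val z) l.
  have nz : nbhs z (val @^-1` ball (val z) del).
    have vcont := @initial_continuous _ _ (val : limit_set -> _).
    exact: vcont (nbhsx_ballx _ _ del0).
  apply: filterS nz => z'; rewrite /= -ball_normE /= => zz'; apply: Weps.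
  apply: lP (fP _) (fP _) (limP _) (limP _) _ => x y xl yl xz yz'.
  by exists (val z); split=> //; exact: near yl yz' _.
- apply: continuous_comp_initial; apply/continuousP => W oW.
  pose U : set completion := [set xi | boundary xi ->
    exists z, [/\ limit_set z, represents z xi & W z]].
  exists U; last first.
    apply/seteqP; split=> xi /=.
      move=> /(_ (bndP xi))[z [_ xiz Wz]].
      by rewrite -(represents_fun (gP xi) xiz (bndP xi)) in Wz.
    by move=> Wxi _; exists (val (g xi)); split=> //; exact: limP.
  move=> xi Uxi; have [bxi|] := pselect (boundary xi); last first.
    move=> /contrapT[x _ <-]; exists (expR (- a * (lev x)%:R)).
      exact: expR_gt0.
    by move=> eta /embed_isolated -> bx; exfalso; apply: bx; exists x.
  have [z [Ez xiz Wz]] := Uxi bxi.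
  move: oW; rewrite openE => /(_ z Wz)/nbhs_ballP[eps /= eps0 Weps].
  have [del del0 delP] := rho_ext_controls_dist eps0.
  exists del => // eta xieta beta.
  have [z' Ez' etaz'] := boundary_represented beta.
  exists z'; split=> //; apply: Weps; rewrite -ball_normE /=.
  exact: delP xiz etaz' Ez Ez' bxi xieta.
Qed.

(** The exponent of the Hoelder equivalence turns the base [expR (- a)] of the
metric into the contraction ratio [rr] of the cells. *)
Lemma rho_ext_powR xi eta : xi <> eta ->
  rho_ext xi eta `^ (- ln rr / a) = rr `^ fine (gp_ext xi eta).
Proof.
move=> /eqP/negbTE xieta; rewrite /Defs.rho_ext xieta.
rewrite /powR !gt_eqF ?expR_gt0 // expRK; congr expR; field.
by rewrite gt_eqF.
Qed.

(** With [G] the Gromov product of two boundary points and [z], [z'] their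
images, the cells through [z] and [z'] meet at the last level [l] with
[eucl_norm (z - z') < C' * rr ^+ l], whence [l - 1 <= G]; conversely
[`|z - z'| <= 5 * D * rr ^+ l] for all [l < G].  Rounding [G] to an integer
costs the factors [rr ^+ 2]. *)
Theorem boundary_hoelder_equivalent (C' : R) : 0 < C' ->
  (forall x y, lev x = lev y -> cell x `&` cell y !=set0 \/
    forall z z', cell x z -> cell y z' ->
      C' * rr ^+ lev x <= eucl_norm (z - z')) ->
  hoelder_equivalent e o a limit_set.
Proof.
move=> C'0 sep.
have /choice[Phi PhiP] : forall xi, exists z,
    boundary xi -> limit_set z /\ represents z xi.
  move=> xi; have [bxi|nbxi] := pselect (boundary xi); last by exists 0.
  by have [z Ez xiz] := boundary_represented bxi; exists z.
have /andP[_ rr2] := ratio_bounds T.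
have rr1 : 0 < rr <= 1 by rewrite rr_gt0 /=; lra.
pose C1 := d%:R * (5 * D) / rr ^+ 2; pose C2 := (C' * rr ^+ 2)^-1.
have C1_ge0 : 0 <= C1 by rewrite /C1 divr_ge0 ?rrX_ge0 ?mulr_ge0 ?(ltW D_gt0).
have C2_gt0 : 0 < C2 by rewrite invr_gt0 mulr_gt0 ?exprn_gt0.
have al0 : 0 < - ln rr / a.
  by rewrite divr_gt0 // oppr_gt0 ln_lt0 // rr_gt0 /=; lra.
exists Phi, (C1 + C2), (- ln rr / a); split=> //.
- split.
  + by move=> xi /PhiP[].
  + move=> xi eta /set_mem/PhiP[_ xiz] /set_mem/PhiP[_ etaz] xieta.
    by rewrite -xieta in etaz; exact: represents_inj xiz etaz.
  + move=> z /limit_set_represents[xi bxi xiz]; exists xi => //.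
    by have [_ xiz'] := PhiP _ bxi; exact: represents_fun xiz' xiz bxi.
- exact: ltr_wpDl.
move=> xi eta bxi beta.
have [Ez xiz] := PhiP _ bxi; have [Ez' etaz'] := PhiP _ beta.
have [xieta|/eqP xieta] := eqVneq xi eta.
  rewrite xieta subrr eucl_norm0 !mulr0 /Defs.rho_ext eqxx powR0 ?lexx //.
  by rewrite gt_eqF.
rewrite (rho_ext_powR xieta).
have gfin := gromov_prod_ext_fin_num xiz etaz' Ez Ez' xieta.
have g0 := gromov_prod_ext_ge0 xiz etaz' Ez Ez'.
set G := fine _; have GE : gp_ext xi eta = G%:E by rewrite fineK.
rewrite GE lee_fin in g0.
move: Ez Ez' xiz etaz'; set z := Phi xi; set z' := Phi eta => Ez Ez' xiz etaz'.
have E2 t : rr `^ (t + 2) = rr `^ t * rr ^+ 2.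
  by rewrite powRD ?(gt_eqF rr_gt0) ?implybT // powR_mulrn ?(ltW rr_gt0).
apply/andP; split.
- rewrite mulrC ler_pdivrMr ?ltr_wpDl //.
  have zz' : `|z - z'| <= 5 * D * rr ^+ (Num.truncn G).-1.
    have /andP[Gl _] := truncn_itv g0.
    case: (Num.truncn G) Gl => [|l] Gl /=.
      have root w : limit_set w -> cell o w.
        by move=> /(_ 0%N I)[x /= x0]; rewrite -(anc_root T x) (anc_id T) ?x0.
      have := cell_diam T (root _ Ez) (root _ Ez').
      rewrite (lev_root T) expr0; move: D_gt0; lra.
    apply: (dist_le_of_gromov_prod_ext xiz etaz'); rewrite GE lte_fin.
    by apply: lt_le_trans Gl; rewrite ltr_nat.
  apply: le_trans (eucl_norm_le_norm _) _.
  apply: (@le_trans _ _ (C1 * rr `^ G)); last first.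
    by rewrite mulrC ler_wpM2l ?powR_ge0 // lerDl ltW.
  apply: le_trans (ler_wpM2l (ler0n _ _) zz') _.
  rewrite /C1 -!mulrA !ler_wpM2l // ?(ltW D_gt0) //.
  rewrite mulrC ler_pdivlMr ?exprn_gt0 //.
  rewrite -powR_mulrn ?(ltW rr_gt0) // -E2; apply: ger_powR => //.
  exact: le_truncn_pred.
- pose dzz' := eucl_norm (z - z').
  have dzz'0 : 0 < dzz'.
    apply: lt_le_trans (norm_le_eucl_norm _); rewrite normr_gt0 subr_eq0.
    apply/eqP => zz'; apply: xieta; rewrite -zz' in etaz'.
    exact: represents_inj xiz etaz'.
  (* The least such l is used: at level l the points are closer than
     C' * rr ^+ l, unless l = 0, where the bound on G is trivial. *)
  have ex : exists l, C' * rr ^+ l.+1 <= dzz'.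
    have [l /ltW lE] := rrX_small C' dzz'0; exists l; apply: le_trans lE.
    by rewrite ler_wpM2l ?(ltW C'0) // rrX_le.
  have lG : (ex_minn ex)%:R - 1 <= G.
    case: ex_minnP => -[|l] _ lmin; first by lra.
    rewrite -lee_fin -GE; apply: (gromov_prod_ext_ge_of_meet xiz etaz' Ez Ez').
    move=> x y xl yl xz yz'.
    have [//|/(_ _ _ xz yz')] := sep x y (etrans xl (esym yl)).
    by rewrite xl => /lmin; rewrite ltnn.
  case: ex_minnP lG => l lE _ lG.
  apply: (@le_trans _ _ (C2 * dzz')); last first.
    by rewrite ler_wpM2r ?(ltW dzz'0) // lerDr.
  rewrite /C2 mulrC ler_pdivlMr ?mulr_gt0 ?exprn_gt0 //.
  rewrite [C' * _]mulrC mulrA -E2 mulrC; apply: le_trans lE.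
  rewrite ler_wpM2l ?(ltW C'0) // -powR_mulrn ?(ltW rr_gt0) //.
  by apply: ger_powR => //; rewrite -natr1; lra.
Qed.

End Boundary.

End AugmentedTree.

Arguments limit_set {R d V} lev cell.

(** * Words and levels of a Moran structure *)

Section MoranWords.
Context {n : nat -> nat}.
Implicit Types (w : seq nat) (k j : nat).

Lemma words0 w : words n 0 w <-> w = [::].
Proof. by split=> [[/size0nil ->]|->]. Qed.

Lemma words_rcons k w j :
  words n k.+1 (rcons w j) <-> words n k w /\ (1 <= j <= n k.+1)%N.
Proof.
rewrite /words /= size_rcons; split.
  move=> [[sw] wP]; split; last first.
    by have := wP k (ltnSn _); rewrite nth_rcons sw ltnn eqxx.
  by split=> // i ik; have := wP i (leqW ik); rewrite nth_rcons sw ik.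
move=> [[sw wP] jP]; split=> [|i]; first by rewrite sw.
rewrite ltnS nth_rcons sw leq_eqVlt => /orP[/eqP ->|ik].
  by rewrite ltnn eqxx.
by rewrite ik wP.
Qed.

Lemma words_take k l w : words n k w -> (l <= k)%N -> words n l (take l w).
Proof.
move=> [sw wP] lk; split=> [|i il]; first by rewrite size_takel ?sw.
by rewrite nth_take // wP // (leq_trans il).
Qed.

Lemma finite_words k : finite_set (words n k).
Proof.
elim: k => [|k IH].
  by apply: sub_finite_set (finite_set1 [::]) => w /words0.
have : finite_set ((fun p => rcons p.1 p.2) @`
    (words n k `*` [set j | (j < (n k.+1).+1)%N])).
  by apply: finite_image; apply: finite_setX => //; exact: finite_II.
apply: sub_finite_set => w; case/lastP: w => [[]//|w j].
move=> /words_rcons[wk /andP[_ jn]].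
by exists (w, j).
Qed.

End MoranWords.

Section MoranTree.
Context {R : realType} {d : nat} {n : nat -> nat} {r : nat -> R}
  {J : set 'rV[R]_d} {Jf : seq nat -> set 'rV[R]_d}.
Hypothesis n_ge2 : forall k, (1 <= k)%N -> (2 <= n k)%N.
Hypothesis r_bounds : forall k, (1 <= k)%N -> 0 < r k < 1.
Hypothesis nr_le1 : forall k, (1 <= k)%N -> (n k)%:R * r k <= 1.
Hypothesis J_compact : compact J.
Hypothesis J_interior : interior J !=set0.
Hypothesis Jf_moran : moran_structure n r J Jf.
Hypothesis inf_ratio_gt0 : 0 < inf_ratio r.
Implicit Types (w : seq nat) (k l m : nat).

Local Notation p := (ratio_prod r).
Local Notation rho := (inf_ratio r).
Local Notation level := (level n r).
Local Notation vertices := (vertices n r).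

Lemma inf_ratio_le k : (1 <= k)%N -> rho <= r k.
Proof.
move=> k1; apply: ge_inf; last by exists k.
by exists 0 => _ [j /r_bounds/andP[/ltW r0 _] <-].
Qed.

Lemma ratio_le_half k : (1 <= k)%N -> r k <= 2^-1.
Proof.
move=> k1; have := nr_le1 k1; have /andP[r0 _] := r_bounds k1.
have : 2 <= (n k)%:R :> R by rewrite ler_nat n_ge2.
by nra.
Qed.

Lemma inf_ratio_bounds : 0 < rho <= 2^-1.
Proof.
rewrite inf_ratio_gt0 /=.
exact: le_trans (inf_ratio_le (leqnn 1)) (ratio_le_half (leqnn 1)).
Qed.

Lemma ratio_prod0 : p 0 = 1.
Proof. by rewrite /ratio_prod big_nil. Qed.

Lemma ratio_prodS k : p k.+1 = p k * r k.+1.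
Proof. by rewrite /ratio_prod big_nat_recr. Qed.

Lemma ratio_prod_gt0 k : 0 < p k.
Proof.
elim: k => [|k IH]; first by rewrite ratio_prod0.
by rewrite ratio_prodS mulr_gt0 //; have /andP[] := r_bounds (ltn0Sn k).
Qed.

Lemma ratio_prod_nonincreasing k l : (k <= l)%N -> p l <= p k.
Proof.
move=> /subnK <-; elim: (l - k)%N => // i; apply: le_trans.
rewrite addSn ratio_prodS ger_pMr ?ratio_prod_gt0 //.
by have /andP[_ /ltW] := r_bounds (ltn0Sn (i + k)).
Qed.

Lemma ratio_prod_le_inf_ratioX m : exists k, p k <= rho ^+ m.
Proof.
have half_small : `|2^-1 : R| < 1 by rewrite gtr0_norm; lra.
have := cvg_expr half_small; move=> /cvgr0Pnorm_lt.
move=> /(_ _ (exprn_gt0 m inf_ratio_gt0))[k _ /(_ k (leqnn k)) /ltW kP].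
exists k; apply: le_trans kP; rewrite /= ger0_norm ?exprn_ge0 //.
elim: k => [|k IH]; first by rewrite ratio_prod0.
rewrite ratio_prodS exprSr ler_pM ?(ltW (ratio_prod_gt0 _)) //.
  by have /andP[/ltW] := r_bounds (ltn0Sn k).
exact: ratio_le_half.
Qed.

(** As the ratio depends on the position in a word only, all words of one level
have the same length. *)
Definition level_length m : nat := ex_minn (ratio_prod_le_inf_ratioX m).
Local Notation len := level_length.

Lemma ratio_prod_level_length m : p (len m) <= rho ^+ m.
Proof. by rewrite /len; case: ex_minnP. Qed.

Lemma lt_level_length m k : (k < len m)%N = (rho ^+ m < p k).
Proof.
rewrite /len; case: ex_minnP => l lP lmin; apply/idP/idP => [kl|kP].
  by rewrite ltNge; apply: contraTN kl => /lmin; rewrite -leqNgt.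
rewrite ltnNge; apply: contraTN kP => /ratio_prod_nonincreasing lk.
by rewrite -leNgt (le_trans lk).
Qed.

(** The length is the first one at which the product of the ratios drops below
[rho ^+ m], so it has dropped by one factor, which is at least [rho]. *)
Lemma lt_ratio_prod_level_length m : rho ^+ m.+1 < p (len m).
Proof.
have /andP[_ rho2] := inf_ratio_bounds.
case E: (len m) => [|k].
  by rewrite ratio_prod0 exprn_ilt1 ?(ltW inf_ratio_gt0) //; lra.
have : (k < len m)%N by rewrite E.
rewrite lt_level_length ratio_prodS exprSr => kP.
apply: (@lt_le_trans _ _ (p k * rho)); first by rewrite ltr_pM2r.
by rewrite ler_pM2l ?ratio_prod_gt0 ?inf_ratio_le.
Qed.

Lemma level_length_lt l m : (l < m)%N = (len l < len m)%N.
Proof.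
have mono : {homo len : l m / (l < m)%N}.
  apply: homo_ltn; first exact: ltn_trans.
  by move=> i; rewrite lt_level_length lt_ratio_prod_level_length.
by rewrite (leqW_mono (leq_mono mono)).
Qed.

Lemma level_length_le l m : (len l <= len m)%N = (l <= m)%N.
Proof. by rewrite leqNgt -level_length_lt -leqNgt. Qed.

Lemma level_length_inj : injective len.
Proof.
move=> l m lm; apply/eqP.
by rewrite eqn_leq -(level_length_le l m) -(level_length_le m l) lm leqnn.
Qed.

Lemma leq_level_length m : (m <= len m)%N.
Proof.
elim: m => // m IH; apply: leq_ltn_trans IH _; by rewrite -level_length_lt.
Qed.

Lemma level_length0 : len 0 = 0%N.
Proof.
apply/eqP; rewrite -leqn0 leqNgt lt_level_length.
by rewrite ratio_prod0 expr0 ltxx.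
Qed.

Lemma levelE m : level m = words n (len m).
Proof.
apply/seteqP; case: m => [|m]; rewrite /Defs.level; split=> w.
- by move=> /= ->; rewrite level_length0; apply/words0.
- by rewrite level_length0 => /words0.
- move=> [k kw /andP[pk1 pk]].
  rewrite (_ : len m.+1 = k.+1) //; apply/eqP; rewrite eqn_leq.
  by rewrite leqNgt !lt_level_length pk -leNgt pk1.
- case E: (len m.+1) => [|k] kw.
    by have := leq_level_length m.+1; rewrite E.
  exists k => //; rewrite -lt_level_length E ltnSn andbT.
  by rewrite -E ratio_prod_level_length.
Qed.

(** * Geometry of the pieces of a Moran structure *)

Local Notation D0 := (eucl_diam J).

Lemma Jf_root : Jf [::] = J.
Proof. by case: Jf_moran. Qed.

Lemma Jf_rcons k w j : words n k.+1 (rcons w j) -> Jf (rcons w j) `<=` Jf w.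
Proof.
case: Jf_moran => _ _ nest _ /words_rcons[kw jn].
by have [sub _] := nest k w kw; exact: sub.
Qed.

Lemma Jf_take k l w : words n k w -> Jf w `<=` Jf (take l w).
Proof.
elim: k w => [|k IH] w kw; first by move/words0: kw => ->.
case: (leqP k.+1 l) => kl; first by rewrite take_oversize //; case: kw => ->.
case/lastP: w kw => [[]//|w j] kwj; have [kw _] := (words_rcons k w j).1 kwj.
rewrite -cats1 takel_cat; last by case: kw => ->.
by rewrite cats1; apply: subset_trans (Jf_rcons kwj) (IH _ kw).
Qed.

(** A piece has nonzero diameter because the quotient of the diameters of its
children by its own is positive. *)
Lemma eucl_diam_Jf_rcons k w j : words n k.+1 (rcons w j) ->
  eucl_diam (Jf w) != 0 /\
  eucl_diam (Jf (rcons w j)) = eucl_diam (Jf w) * r k.+1.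
Proof.
case: Jf_moran => _ _ _ ratio /words_rcons[kw jn].
have e := ratio k w j kw jn; have /andP[r0 _] := r_bounds (ltn0Sn k).
have w0 : eucl_diam (Jf w) != 0.
  by apply: contraTneq r0 => w0; rewrite -e w0 invr0 mulr0 ltxx.
by split=> //; rewrite -e mulrC divfK.
Qed.

Lemma eucl_diam_Jf k w : words n k w -> eucl_diam (Jf w) = p k * D0.
Proof.
elim: k w => [|k IH] w kw.
  by move/words0: kw => ->; rewrite Jf_root ratio_prod0 mul1r.
case/lastP: w kw => [[]//|w j] kwj; have [kw _] := (words_rcons k w j).1 kwj.
by rewrite (eucl_diam_Jf_rcons kwj).2 (IH _ kw) ratio_prodS mulrAC.
Qed.

Lemma has_ubound_eucl_norm (A : set 'rV[R]_d) : A `<=` J ->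
  has_ubound [set eucl_norm (x - y) | x in A & y in A].
Proof.
move=> AJ; have [M [_ MJ]] := compact_bounded J_compact.
have {MJ} MJ x : J x -> `|x| <= M + 1 by move=> Jx; apply: MJ => //; lra.
exists (d%:R * (M + 1 + (M + 1))) => _ [x Ax [y Ay <-]].
apply: le_trans (eucl_norm_le_norm _) _; rewrite ler_wpM2l //.
by apply: le_trans (ler_normB _ _) _; rewrite lerD ?MJ //; exact: AJ.
Qed.

Lemma Jf_sub_J k w : words n k w -> Jf w `<=` J.
Proof. by move=> kw; case: Jf_moran => _ /(_ w) h _ _; apply h; exists k. Qed.

Lemma eucl_norm_le_diam (A : set 'rV[R]_d) x y :
  A `<=` J -> A x -> A y -> eucl_norm (x - y) <= eucl_diam A.
Proof.
move=> AJ Ax Ay; apply: ub_le_sup; first exact: has_ubound_eucl_norm.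
by exists x => //; exists y.
Qed.

Lemma words1 : words n 1 [:: 1%N].
Proof.
apply: (words_rcons 0 [::] 1).2; split; first exact/words0.
by rewrite (leq_trans _ (n_ge2 (leqnn 1))).
Qed.

Lemma J_diam_gt0 : 0 < D0.
Proof.
have [x0 /nbhs_singleton Jx0] := J_interior.
have [+ _] := @eucl_diam_Jf_rcons 0 [::] 1 words1; rewrite Jf_root => D00.
rewrite lt_def D00; have := eucl_norm_le_diam (@subset_refl _ J) Jx0 Jx0.
by rewrite subrr eucl_norm0.
Qed.

Lemma Jf_diam k w x y : words n k w -> Jf w x -> Jf w y -> `|x - y| <= D0 * p k.
Proof.
move=> kw wx wy; rewrite mulrC -(eucl_diam_Jf kw).
apply: le_trans (norm_le_eucl_norm _) (eucl_norm_le_diam _ wx wy).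
exact: Jf_sub_J kw.
Qed.

Lemma Jf_closed k w : words n k w -> closed (Jf w).
Proof.
move=> kw; have [_ [S [c c0 Sc] ->]] : Jf w `<=` J /\
    exists2 S, similarity S & Jf w = S @` J.
  by case: Jf_moran => _ /(_ w) h _ _; apply: h; exists k.
apply: compact_closed; first exact: norm_hausdorff.
apply: continuous_compact => //; apply: continuous_subspaceT.
move=> x; apply/(@cvgrPdist_lt _ _ _ (nbhs x)) => eps eps0.
have cd0 : 0 < c * d.+1%:R by rewrite mulr_gt0.
apply/nbhs_ballP; exists (eps / (c * d.+1%:R)); first by rewrite /= divr_gt0.
move=> y; rewrite -ball_normE /= ltr_pdivlMr // mulrC => xy.
apply: le_lt_trans (norm_le_eucl_norm _) _; rewrite Sc.
apply: le_lt_trans xy; rewrite -mulrA ler_pM2l //.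
by apply: le_trans (eucl_norm_le_norm _) _; rewrite ler_wpM2r // ler_nat.
Qed.

(** A piece of ratio [p k] contains a ball of radius comparable to [p k]: the
similarity onto the piece has ratio at least [p k], and, being onto, it sends a
ball in [J] onto a ball. *)
Lemma Jf_ball : exists2 s, 0 < s & forall k w, words n k w ->
  exists q, ball q (p k * s) `<=` Jf w.
Proof.
have [x0] := J_interior; rewrite /interior /= => /nbhs_ballP[s0 /= s00 ballJ].
exists (s0 / d.+1%:R) => [|k w kw]; first by rewrite divr_gt0.
have [wJ [S [c c0 Sc] wS]] : Jf w `<=` J /\
    exists2 S, similarity S & Jf w = S @` J.
  by case: Jf_moran => _ /(_ w) h _ _; apply: h; exists k.
have pc : p k <= c.
  rewrite -(ler_pM2r J_diam_gt0) -(eucl_diam_Jf kw) wS.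
  apply: ge_sup.
    have SJx0 : (S @` J) (S x0) by exists x0 => //; exact: ballJ (ballxx _ s00).
    by exists (eucl_norm (S x0 - S x0)); exists (S x0) => //; exists (S x0).
  move=> _ [_ [x Jx <-] [_ [y Jy <-] <-]]; rewrite Sc ler_pM2l //.
  exact: eucl_norm_le_diam.
exists (S x0) => y; rewrite -ball_normE /= => yball; rewrite wS.
have [x xy] := similarity_surjective c0 Sc y; exists x => //.
apply: ballJ; rewrite -ball_normE /=.
apply: le_lt_trans (norm_le_eucl_norm _) _.
rewrite -(ltr_pM2l c0) -Sc xy; apply: le_lt_trans (eucl_norm_le_norm _) _.
apply: (@le_lt_trans _ _ (d.+1%:R * `|S x0 - y|)).
  by rewrite ler_wpM2r // ler_nat.
rewrite mulrC -ltr_pdivlMr // -mulrA; apply: lt_le_trans yball _.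
by rewrite ler_wpM2r // divr_ge0 // ltW.
Qed.

(** Distinct words of equal length have distinct sibling prefixes, and the
pieces of siblings have disjoint interiors. *)
Lemma interior_Jf_disjoint k u v : words n k u -> words n k v -> u <> v ->
  interior (Jf u) `&` interior (Jf v) = set0.
Proof.
elim: k u v => [|k IH] u v; first by move=> /words0-> /words0->.
case/lastP: u => [[]//|u i]; case/lastP: v => [_ []//|v j] kui kvj uivj.
have [ku iP] := (words_rcons k u i).1 kui.
have [kv jP] := (words_rcons k v j).1 kvj.
have [uv|/eqP uv] := eqVneq u v.
  case: Jf_moran => _ _ nest _; have [_] := nest k u ku.
  by rewrite -uv; apply=> // ij; apply: uivj; rewrite uv ij.
apply/seteqP; split=> // x [xu xv]; rewrite -(IH u v ku kv uv).
by split; [move: xu | move: xv]; apply: interiorS;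
  [exact: Jf_rcons kui | exact: Jf_rcons kvj].
Qed.

Lemma centers_far k u v (q q' : 'rV[R]_d) (s : R) : 0 < s ->
  words n k u -> words n k v -> u <> v ->
  ball q (p k * s) `<=` Jf u -> ball q' (p k * s) `<=` Jf v ->
  p k * s <= `|q - q'|.
Proof.
move=> s0 ku kv uv qu qv; rewrite leNgt; apply/negP => qq'.
have ps0 : 0 < p k * s by rewrite mulr_gt0 ?ratio_prod_gt0.
suff : set0 q' by [].
rewrite -(interior_Jf_disjoint ku kv uv); split.
- apply: filterS qu _; apply: open_nbhs_nbhs; split; first exact: ball_open.
  by rewrite -ball_normE.
- by apply: filterS qv _; exact: nbhsx_ballx.
Qed.

(** * The tree of cells of a Moran structure *)

Implicit Types x y : vertices.

Definition vertex_level x : nat := xget 0%N [set m | level m (val x)].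
Local Notation lev := vertex_level.

Lemma vertex_levelP x : words n (len (lev x)) (val x).
Proof.
rewrite -levelE; have [m _ xm] : vertices (val x) := set_mem (valP x).
exact: (@xgetI _ 0%N [set m | level m (val x)] m xm).
Qed.

Lemma size_vertex x : size (val x) = len (lev x).
Proof. by have [] := vertex_levelP x. Qed.

Lemma vertex_level_eq m x : level m (val x) -> lev x = m.
Proof.
by rewrite levelE => -[xm _]; apply: level_length_inj; rewrite -size_vertex.
Qed.

Lemma level_vertex_level x : level (lev x) (val x).
Proof. by rewrite levelE; exact: vertex_levelP. Qed.

Definition ancestor l x : vertices :=
  insubd (aug_root n r) (take (len l) (val x)).

Lemma val_ancestor l x : val (ancestor l x) = take (len l) (val x).
Proof.
rewrite val_insubd; case: ifPn => // /negP[]; apply/mem_set.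
have [lx|xl] := leqP l (lev x).
  exists l => //; rewrite levelE; apply: words_take (vertex_levelP x) _.
  by rewrite level_length_le.
exists (lev x) => //; rewrite take_oversize; first exact: level_vertex_level.
by rewrite size_vertex level_length_le ltnW.
Qed.

Lemma ancestor_level l x : (l <= lev x)%N -> level l (val (ancestor l x)).
Proof.
move=> lx; rewrite val_ancestor levelE; apply: words_take (vertex_levelP x) _.
by rewrite level_length_le.
Qed.

Lemma aug_edgeP x y : aug_edge n r Jf x y <->
  [\/ lev x = (lev y).+1 /\ ancestor (lev y) x = y,
      lev y = (lev x).+1 /\ ancestor (lev x) y = x |
      [/\ x <> y, lev x = lev y & Jf (val x) `&` Jf (val y) !=set0]].
Proof.
have parentE u v : parent n r (val u) (val v) <->
    lev u = (lev v).+1 /\ ancestor (lev v) u = v.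
  split=> [[m [um vm]]|[uv vu]].
    rewrite (vertex_level_eq um) (vertex_level_eq vm) prefixE => /eqP uv.
    split=> //; apply: val_inj.
    by rewrite val_ancestor -[in RHS]uv size_vertex (vertex_level_eq vm).
  exists (lev v); split; [rewrite -uv| |]; try exact: level_vertex_level.
  by rewrite -[in X in prefix X _]vu val_ancestor prefix_take.
have horizontalE : horizontal n r Jf (val x) (val y) <->
    [/\ x <> y, lev x = lev y & Jf (val x) `&` Jf (val y) !=set0].
  split=> [[xy [m [xm ym xJy]]]|[xy lxy xJy]].
    split=> //; first by move=> xy'; apply: xy; rewrite xy'.
    by rewrite (vertex_level_eq xm) (vertex_level_eq ym).
  split; first by move=> /val_inj.
  case E: (lev x) => [|m].
    exfalso; apply: xy; apply: val_inj.
    have := level_vertex_level x; have := level_vertex_level y.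
    by rewrite -lxy E => /= -> ->.
  exists m; split=> //; rewrite -E; last rewrite lxy;
    exact: level_vertex_level.
split.
  by move=> /asboolP[/parentE|/parentE|/horizontalE];
    [constructor 1|constructor 2|constructor 3].
move=> exy; apply/asboolP.
by case: exy => [/parentE|/parentE|/horizontalE];
  [constructor 1|constructor 2|constructor 3].
Qed.

Theorem moran_cell_tree : exists s center,
  cell_tree (aug_edge n r Jf) (aug_root n r) lev ancestor
    (fun x => Jf (val x)) center rho D0 s.
Proof.
have [s0 s00 ballP] := Jf_ball.
have /choice[center centerP] : forall x : vertices, exists q,
    ball q (p (len (lev x)) * s0) `<=` Jf (val x).
  by move=> x; exact: ballP (vertex_levelP x).
exists (rho * s0), center; split.
- exact: inf_ratio_bounds.
- exact: J_diam_gt0.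
- by rewrite mulr_gt0.
- exact: vertex_level_eq.
- by move=> l x lx; apply: vertex_level_eq; exact: ancestor_level.
- move=> l x xl; apply: val_inj; rewrite val_ancestor take_oversize //.
  by rewrite size_vertex level_length_le.
- move=> l m x lm; apply: val_inj; rewrite !val_ancestor take_takel //.
  by rewrite level_length_le.
- by move=> x; apply: val_inj; rewrite val_ancestor level_length0 take0.
- exact: aug_edgeP.
- by move=> l x; rewrite val_ancestor; exact: Jf_take (vertex_levelP x).
- by move=> x; exact: Jf_closed (vertex_levelP x).
- move=> l; have : finite_set (insubd (aug_root n r) @` words n (len l)).
    by apply: finite_image; exact: finite_words.
  apply: sub_finite_set => x /= xl; exists (val x); last exact: valKd.
  by rewrite -xl; exact: vertex_levelP.
- move=> x z z' xz xz'; apply: le_trans (Jf_diam (vertex_levelP x) xz xz') _.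
  by rewrite ler_pM2l ?J_diam_gt0 // ratio_prod_level_length.
- move=> x; apply: centerP; apply: ballxx.
  by rewrite mulr_gt0 ?ratio_prod_gt0.
- move=> x y xy lxy.
  have xy' : val x <> val y by move=> /val_inj.
  have yP := centerP y; rewrite -lxy in yP.
  have yW := vertex_levelP y; rewrite -lxy in yW.
  apply: le_trans (centers_far s00 (vertex_levelP x) yW xy' (centerP x) yP).
  by rewrite mulrAC -exprS ler_pM2r // ltW // lt_ratio_prod_level_length.
Qed.

Lemma moran_setE : moran_set n Jf = limit_set lev (fun x => Jf (val x)).
Proof.
apply/seteqP; split=> z Ez k _.
  have [w kw wz] := Ez (len k) I.
  have wV : vertices w by exists k => //; rewrite levelE.
  exists (exist _ w (mem_set wV)) => //=; apply: vertex_level_eq.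
  by rewrite levelE.
have [x /= xk xz] := Ez k I; exists (take k (val x)).
  apply: words_take (vertex_levelP x) _; rewrite xk; exact: leq_level_length.
exact: Jf_take (vertex_levelP x) _ xz.
Qed.

End MoranTree.

Theorem theorem1p2 (R : realType) (d : nat) (n : nat -> nat) (r : nat -> R)
  (J : set 'rV[R]_d) (Jf : seq nat -> set 'rV[R]_d)
  (n_ge2 : forall k, (1 <= k)%N -> (2 <= n k)%N)
  (r_bounds : forall k, (1 <= k)%N -> 0 < r k < 1)
  (nr_le1 : forall k, (1 <= k)%N -> (n k)%:R * r k <= 1)
  (J_compact : compact J)
  (J_interior : interior J !=set0)
  (Jf_moran : moran_structure n r J Jf)
  (inf_ratio_gt0 : 0 < inf_ratio r) :
  let E := moran_set n Jf in
  let e := aug_edge n r Jf in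
  let o := aug_root n r in
  hyperbolic R e o /\
  forall delta a : R,
    0 < delta -> hyperbolic_with e o delta ->
    0 < a -> expR (delta * a) - 1 < Num.sqrt 2 - 1 ->
    homeomorphic E (hyp_boundary e o a) /\
    ((exists2 C' : R, 0 < C' &
        forall m u v, (1 <= m)%N -> level n r m u -> level n r m v ->
          Jf u `&` Jf v !=set0 \/
          C' * inf_ratio r ^+ m <= eucl_dist (Jf u) (Jf v)) ->
     hoelder_equivalent e o a E).
Proof.
move=> E e o.
have [s [center T]] := moran_cell_tree n_ge2 r_bounds nr_le1 J_compact
  J_interior Jf_moran inf_ratio_gt0.
split; first exact: cell_tree_hyperbolic T.
move=> delta a _ _ a0 _.
rewrite /E (moran_setE n_ge2 r_bounds nr_le1 Jf_moran inf_ratio_gt0).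
split; first exact: (limit_set_homeomorphic_boundary T a0).
move=> [C' C'0 sep]; apply: (boundary_hoelder_equivalent T a0 C'0) => x y xy.
case E0: (vertex_level x) => [|m].
  have root_eq v : vertex_level v = 0%N -> v = aug_root n r.
    by move=> v0; rewrite -(anc_root T v) (anc_id T) ?v0.
  have xy0 : x = y by rewrite (root_eq x E0) (root_eq y) // -xy.
  by left; exists (center x); split; rewrite -?xy0; exact: (center_cell T).
have lvl := level_vertex_level n_ge2 r_bounds nr_le1 inf_ratio_gt0.
have xm : level n r m.+1 (val x) by rewrite -E0; exact: lvl.
have ym : level n r m.+1 (val y) by rewrite -E0 xy; exact: lvl.
have [|dxy] := sep m.+1 _ _ (ltn0Sn m) xm ym; [by left|right => z z' xz yz'].
apply: le_trans dxy _; apply: ge_inf; last by exists z => //; exists z'.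
by exists 0 => _ [u _ [v _ <-]]; exact: eucl_norm_ge0.
Qed.
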